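(* There is an absolute constant $c>0$ such that the following holds. Let $D$ be a distribution over $X\times Y$, let $S=\{(x_j,y_j)\}_{j=1}^n\sim D^n$, let $\{h_w:w\in\mathbb R^m\}$ be a parameterized class of functions $h_w:X\to\mathbb R^C$, and let $\Theta:=\{\overline w\in\mathbb R^m:\|\overline w\|_2\le R\}$. Fix $\sigma_{\max}>0$ and for $i\ge1$ define $\sigma_i:=2^{1-i}\sigma_{\max}$. For $\overline w\in\Theta$ and $i\ge1$, let $Q_{\overline w,\sigma_i}:=\mathcal N(\overline w,\sigma_i^2I_m)$. Let $L$ be a loss function such that for each $y$ the map $z\mapsto L(z,y)$ is differentiable, $\ell$-Lipschitz and $\beta$-smooth, and assume that the regularity hypotheses $\mathrm{Reg}(\sigma)$ stated in the context hold for $\sigma=\sigma_i$ for every $i\ge1$. Assume moreover that there exists $B>0$ such that for all $(x,y)$, all $\overline w\in\Theta$ and all $i\ge1$, $$\big|\operatorname{Jen}_{Q_{\overline w,\sigma_i}}[L(h_w(x),y)]\big|\le\sigma_i^2B.$$ Then, for any $\delta\in(0,1)$, with probability at least $1-\delta$ over $S\sim D^n$, we have uniformly for all $i\ge1$ and all $\overline w\in\Theta$, $$\begin{aligned}\mathbb E_{(x,y)\sim D}\big[\operatorname{Jen}_{Q_{\overline w,\sigma_i}}(L(h_w(x),y))\big]\le{}&\frac1n\sum_{j=1}^n\operatorname{Jen}_{Q_{\overline w,\sigma_i}}(L(h_w(x_j),y_j))+2c\,\frac{R\sigma_i}{\sqrt n}\sqrt{\beta^2J_{S,\sigma_i}+\ell^2H_{S,\sigma_i}}\\&+8\sigma_i^2B\sqrt{\frac{4\ln(i)+2\ln(8/\delta)}{n}},\end{aligned}$$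 where $J_{S,\sigma_i}$ and $H_{S,\sigma_i}$ are the sample-dependent quantities defined in the context.
   Context: A map is $\beta$-smooth if it is differentiable with $\beta$-Lipschitz gradient (Euclidean norm). The Jensen gap of $f$ with respect to a distribution $Q$ on $\mathbb R^m$ is $\operatorname{Jen}_Q[f(w)]:=f(\mathbb E_{w\sim Q}[w])-\mathbb E_{w\sim Q}[f(w)]$. Hypotheses $\mathrm{Reg}(\sigma)$, with $u\sim\mathcal N(0,I_m)$, for the (arbitrary) sample $S$ and each $j\in\{1,\dots,n\}$: the map $w\mapsto h_w(x_j)$ is twice continuously differentiable on $\mathbb R^m$; the Gaussian expectations below and $\mathbb E_u[L(h_{w+\sigma u}(x_j),y_j)]$ are finite, and the latter may be differentiated in $w$ under the expectation sign. Write $J_j(w):=\nabla_wh_w(x_j)\in\mathbb R^{C\times m}$ and $H_{j,k}(w):=\nabla_w^2(h_w(x_j))_k\in\mathbb R^{m\times m}$. There exist sample-dependent matrices $G_j\succeq0$ with $J_j(w)^\top J_j(w)\preceq G_j$ for all $w\in\Theta$. The quantity $$A_{j,\sigma}:=\sup_{w\in\Theta}\int_0^1\mathbb E_u\big[u^\top J_j(w+t\sigma u)^\top J_j(w+t\sigma u)u\big]dt$$ is finite. There exist sample-dependent matrices $B_{j,\sigma}\succeq0$ such that for all $w\in\Theta$, $$\int_0^1\mathbb E_u\Big[\sum_{k=1}^CH_{j,k}(w+t\sigma u)^\top uu^\top H_{j,k}(w+t\sigma u)\Big]dt\preceq B_{j,\sigma}.$$ Define $J_{S,\sigma}:=\frac1n\sum_{j=1}^nA_{j,\sigma}\operatorname{Trace}(G_j)$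 and $H_{S,\sigma}:=\frac1n\sum_{j=1}^n\operatorname{Trace}(B_{j,\sigma})$. *)

(* Defs.v *)
From HB Require Import structures.
From mathcomp Require Import all_boot all_order all_algebra.
From mathcomp Require Import all_classical all_reals all_analysis.

Set Implicit Arguments.
Unset Strict Implicit.
Unset Printing Implicit Defensive.

Import Order.TTheory GRing.Theory Num.Theory.
Import numFieldNormedType.Exports.

Local Open Scope classical_set_scope.
Local Open Scope ring_scope.

Section product_probability.
Context d (T : measurableType d) (R : realType).

Definition tuple_cons n (p : T * n.-tuple T) : n.+1.-tuple T :=
  [the n.+1.-tuple T of p.1 :: p.2].

Lemma measurable_tuple_cons n : measurable_fun [set: T * n.-tuple T] (@tuple_cons n).
Proof. by apply: measurable_cons. Qed.

HB.instance Definition _ n :=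
  isMeasurableFun.Build _ _ _ _ (@tuple_cons n) (@measurable_tuple_cons n).

Fixpoint prod_prob n : ('I_n -> probability T R) -> probability (n.-tuple T) R :=
  match n with
  | 0 => fun _ => dirac ([tuple] : 0.-tuple T)
  | n'.+1 => fun P =>
      distribution (P ord0 \x prod_prob (fun i => P (lift ord0 i)))%E
                   (@tuple_cons n')
  end.

End product_probability.

Definition iid_prob d (T : measurableType d) (R : realType)
    (P : probability T R) n : probability (n.-tuple T) R :=
  prod_prob (fun _ : 'I_n => P).

(** The event [E] need not be measurable (it may be defined through arbitrary
    functions of the sample), so it is only required to contain a measurable
    event of large probability. *)
Definition with_prob_at_least d (T : measurableType d) (R : realType)
    (P : probability T R) (p : R) (E : set T) :=
  exists A : set T, [/\ measurable A, A `<=` E & (p%:E <= P A)%E].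

Section euclidean.
Context {R : realType}.

(** The library norm on ['rV[R]_m] is the sup norm. *)
Definition enorm m (v : 'rV[R]_m) : R := Num.sqrt (\sum_i v 0 i ^+ 2).

Definition eball m (r : R) : set 'rV[R]_m := [set w | enorm w <= r].

Definition elipschitz m (l : R) (f : 'rV[R]_m -> R) :=
  forall z z', `|f z - f z'| <= l * enorm (z - z').

Definition grad m (f : 'rV[R]_m -> R) (z : 'rV[R]_m) : 'rV[R]_m :=
  \row_k 'D_(delta_mx 0 k) f z.

Definition esmooth m (b : R) (f : 'rV[R]_m -> R) :=
  (forall z, differentiable f z) /\
  (forall z z', enorm (grad f z - grad f z') <= b * enorm (z - z')).

(** The library's ['J f w] acts on row vectors, [dx |-> dx *m 'J f w]; the
    [C x m] Jacobian is its transpose. *)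
Definition jac m C (f : 'rV[R]_m -> 'rV[R]_C) (w : 'rV[R]_m) : 'M[R]_(C, m) :=
  ('J f w)^T.

Definition hess m (f : 'rV[R]_m -> R) (w : 'rV[R]_m) : 'M[R]_m := 'J (grad f) w.

Definition twice_cont_diff m C (f : 'rV[R]_m -> 'rV[R]_C) :=
  (forall w, differentiable f w) /\
  forall k, let fk := fun w => f w 0 k in
    (forall w, differentiable (grad fk) w) /\ continuous (hess fk).

Definition psd m (M : 'M[R]_m) :=
  M^T = M /\ forall v : 'cV[R]_m, 0 <= (v^T *m M *m v) 0 0.

Definition loewner_le m (M N : 'M[R]_m) := psd (N - M).

End euclidean.

Section gaussian.
Context {R : realType}.

(** Distributions on [R^m] live on [m.-tuple R], which carries the product
    sigma-algebra; [vec] is the identification with row vectors. *)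
Definition vec m (t : m.-tuple (measurableTypeR R)) : 'rV[R]_m :=
  \row_a tnth t a.

(** [gauss w s] is [N(w, s^2 I_m)], a product of one-dimensional normal laws
    ([normal_prob] takes the standard deviation). *)
Definition gauss m (w : 'rV[R]_m) (s : R) :
    probability (m.-tuple (measurableTypeR R)) R :=
  prod_prob (fun a : 'I_m =>
    normal_prob (w 0 a) s : probability (measurableTypeR R) R).

Definition std_gauss m := gauss (0 : 'rV[R]_m) 1.

Definition dist_mean m (Q : probability (m.-tuple (measurableTypeR R)) R) :
    'rV[R]_m :=
  \row_a \int[Q]_t (vec t 0 a).

Definition jensen_gap m (Q : probability (m.-tuple (measurableTypeR R)) R)
    (f : 'rV[R]_m -> R) : R :=
  f (dist_mean Q) - \int[Q]_t f (vec t).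

Definition gauss_integrable m (f : 'rV[R]_m -> R) :=
  (std_gauss m).-integrable setT (fun t => (f (vec t))%:E).

Definition gauss_exp m (f : 'rV[R]_m -> R) : R :=
  \int[std_gauss m]_t f (vec t).

End gaussian.

Section regularity.
Context {R : realType} {X Y : Type} {m C : nat}.
Variables (h : 'rV[R]_m -> X -> 'rV[R]_C) (L : 'rV[R]_C -> Y -> R).
Variable r : R.

Notation Theta := (eball r : set 'rV[R]_m).
Notation leb := (@lebesgue_measure R).

Definition model_jac (x : X) (w : 'rV[R]_m) : 'M[R]_(C, m) :=
  jac (fun w' => h w' x) w.

Definition model_hess (x : X) (k : 'I_C) (w : 'rV[R]_m) : 'M[R]_m :=
  hess (fun w' => h w' x 0 k) w.

(** [u^T J(v)^T J(v) u], with [u] stored as a row vector. *)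
Definition jac_form (x : X) (v u : 'rV[R]_m) : R :=
  (u *m (model_jac x v)^T *m model_jac x v *m u^T) 0 0.

(** [\sum_k H_k(v)^T u u^T H_k(v)], with [u] stored as a row vector. *)
Definition hess_form (x : X) (v u : 'rV[R]_m) : 'M[R]_m :=
  \sum_(k < C) (model_hess x k v)^T *m u^T *m u *m model_hess x k v.

(** [A_(j,s)] at [x = x_j], as an extended real; the integrand is
    nonnegative. *)
Definition jac_sup (x : X) (s : R) : \bar R :=
  ereal_sup [set (\int[leb]_(t in `[0%R, 1%R]) \int[std_gauss m]_u
      (jac_form x (w + (t * s) *: vec u)%R (vec u))%:E)%E | w in Theta].

Definition hess_exp (x : X) (s : R) (w : 'rV[R]_m) (t : R) : 'M[R]_m :=
  \matrix_(a, b) gauss_exp (fun u => hess_form x (w + (t * s) *: u) u a b).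

Definition hess_int (x : X) (s : R) (w : 'rV[R]_m) : 'M[R]_m :=
  \matrix_(a, b) \int[leb]_(t in `[0, 1]) hess_exp x s w t a b.

(** The map [w |-> E_u (L (h_(w + s u) x, y))] is differentiable at [w], with
    gradient the expectation of the gradient of the integrand; this includes
    finiteness of the expectations involved (near [w] for the map itself). *)
Definition diff_under_exp (x : X) (y : Y) (s : R) (w : 'rV[R]_m) :=
  let F := fun w' u : 'rV[R]_m => L (h (w' + s *: u) x) y in
  [/\ \forall w' \near w, gauss_integrable (F w'),
      differentiable (fun w' => gauss_exp (F w')) w,
      forall a : 'I_m,
        gauss_integrable (fun u => grad (fun w' => F w' u) w 0 a) &
      grad (fun w' => gauss_exp (F w')) w =
        \row_a gauss_exp (fun u => grad (fun w' => F w' u) w 0 a)].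

Record reg (s : R) (x : X) (y : Y) (G B : 'M[R]_m) : Prop := Reg {
  reg_C2 : twice_cont_diff (fun w => h w x);
  reg_diff : forall w, Theta w -> diff_under_exp x y s w;
  reg_G_psd : psd G;
  reg_G : forall w, Theta w ->
    loewner_le ((model_jac x w)^T *m model_jac x w) G;
  reg_jac_exp : forall w t, Theta w -> 0 <= t <= 1 ->
    gauss_integrable (fun u => jac_form x (w + (t * s) *: u) u);
  reg_jac_sup : jac_sup x s \is a fin_num;
  reg_B_psd : psd B;
  reg_hess_exp : forall w t a b, Theta w -> 0 <= t <= 1 ->
    gauss_integrable (fun u => hess_form x (w + (t * s) *: u) u a b);
  reg_hess_int : forall w a b, Theta w ->
    leb.-integrable `[0, 1] (fun t => (hess_exp x s w t a b)%:E);
  reg_B : forall w, Theta w -> loewner_le (hess_int x s w) B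
}.

Definition J_avg n (G : 'I_n -> 'M[R]_m) (s : R) (xs : 'I_n -> X) : R :=
  n%:R^-1 * \sum_(j < n) fine (jac_sup (xs j) s) * \tr (G j).

Definition H_avg n (B : 'I_n -> 'M[R]_m) : R :=
  n%:R^-1 * \sum_(j < n) \tr (B j).

End regularity.

(* Main.v *)
Require Import Defs.
From HB Require Import structures.
From mathcomp Require Import all_boot all_order all_algebra.
From mathcomp Require Import all_classical all_reals all_analysis.
From mathcomp Require Import measurable_realfun ring lra.

Set Implicit Arguments.
Unset Strict Implicit.
Unset Printing Implicit Defensive.

Import Order.TTheory GRing.Theory Num.Theory.
Import numFieldNormedType.Exports.

Local Open Scope classical_set_scope.
Local Open Scope ring_scope.

(** Fix the sample.  Along a direction [a], the derivative at [w] of the Jensen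
    gap of [w |-> L (h_w x, y)] is the Gaussian mean of
      [<J(w) a, g(w)> - <J(w + s u) a, g(w + s u)>],
    with [g] the gradient of the loss in its first argument.  Smoothness of the
    loss bounds it by the displacement [h_(w + s u) - h_w] times [|J(w) a|], and
    the Lipschitz condition by the variation [(J(w) - J(w + s u)) a]; the
    fundamental theorem of calculus along [t |-> w + t s u] and Tonelli turn the
    second moments of both into the quantities defining [A_j] and [B_j].  Hence
    the gap at the [j]-th sample point is Lipschitz for the seminorm of
      [M_j = 2 s^2 (b^2 A_j G_j + l^2 B_j)].
    Factor [M_j] as a sum of rank-one matrices: the vector contraction principle
    (via Khintchine's inequality) compares the Rademacher average of the gaps
    over the ball with that of linear functionals, which is at most
    [r sqrt (\sum_j tr M_j)] up to a constant, without any dependence on the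
    dimension.  Symmetrization and the bounded difference inequality, applied to
    the supremum minus twice the empirical Rademacher average, give the deviation
    bound at each scale [i]; a union bound with weights [delta / (8 i^2)] concludes.
    Since the sample-dependent matrices need not be measurable, suprema are taken
    over the first [N] points of a dense sequence of the ball, and the good event is
    the limit superior over [N] of the resulting measurable events. *)

(** * Rademacher averages of Lipschitz classes *)

(** The constant is c = sqrt 8. Khintchine's inequality, used with factor 2, gives the 2 in front of
    c; symmetrization doubles the gaps and so multiplies M_j by 4; the inequality (p - q)^2 <= 2 p^2
    + 2 q^2 puts the 2 into M_j itself, whence sqrt (4 * 2).

    The Rademacher average is subtracted before concentration because its bound through A_j, G_j,
    B_j may depend on the sample in a non-measurable way: it can be neither averaged nor
    concentrated, only inserted pointwise on the good event. The subtraction also leaves one event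
    per scale. The resulting difference is not monotone in N, so the events for successive N are not
    nested; this is why their limit superior is taken.

    The matrices G_j dominate only at points of the ball, whereas w + s u may leave it. The product
    rule for the gradient of the gap is therefore arranged so that G_j is used at w alone. *)

Section finite_max.
Context {R : realType}.

Fixpoint fmax (N : nat) (f : nat -> R) : R :=
  if N is N'.+1 then Num.max (fmax N' f) (f N'.+1) else f 0%N.

Lemma le_fmax N f k : (k <= N)%N -> f k <= fmax N f.
Proof.
elim: N => [|N IH]; first by rewrite leqn0 => /eqP->.
rewrite leq_eqVlt => /orP[/eqP->|]; first by rewrite /= le_max lexx orbT.
by rewrite ltnS => /IH kN /=; rewrite le_max kN.
Qed.

Lemma fmax_attained N f : exists2 k, (k <= N)%N & fmax N f = f k.
Proof.
elim: N => [|N [k kN e]]; first by exists 0%N.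
rewrite /= maxEle; case: ifP => _; first by exists N.+1.
by exists k => //; exact: leqW.
Qed.

Lemma fmax_le N f (x : R) :
  (forall k, (k <= N)%N -> f k <= x) -> fmax N f <= x.
Proof. by move=> fx; have [k kN ->] := fmax_attained N f; exact: fx. Qed.

Lemma fmax_leD N (f g : nat -> R) (c : R) :
  (forall k, (k <= N)%N -> f k <= g k + c) -> fmax N f <= fmax N g + c.
Proof.
move=> fg; apply: fmax_le => k kN.
by rewrite (le_trans (fg _ kN))// lerD2r le_fmax.
Qed.

Lemma fmax_dist N (f g : nat -> R) (c : R) :
  (forall k, (k <= N)%N -> `|f k - g k| <= c) -> `|fmax N f - fmax N g| <= c.
Proof.
move=> fg; rewrite ler_distl; apply/andP; split.
  rewrite lerBlDr; apply: fmax_leD => k kN.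
  by have := fg _ kN; rewrite ler_distl => /andP[]; lra.
apply: fmax_leD => k kN.
by have := fg _ kN; rewrite ler_distl => /andP[]; lra.
Qed.

(** Each [a + u - v] is the midpoint of [a + 2 u] and [a - 2 v]. In symmetrization this decouples
    the mean [u] from the sampled value [v]. *)
Lemma fmax_half N (a u v : nat -> R) :
  fmax N (fun k => a k + u k - v k) <=
  2^-1 * fmax N (fun k => a k + 2 * u k) + 2^-1 * fmax N (fun k => a k - 2 * v k).
Proof.
apply: fmax_le => k kN.
have := le_fmax (fun k => a k + 2 * u k) kN.
have := le_fmax (fun k => a k - 2 * v k) kN.
by rewrite /=; lra.
Qed.

End finite_max.

(** * Averages over random signs and their comparison *)

Section sign_average.
Context {R : realType}.

(* The average of [F (a + \sum_i e_i v_i)] over all signs [e_i], for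
   [s = [:: v_1; ...; v_n]]. *)
Fixpoint savg (V : zmodType) (s : seq V) (F : V -> R) (a : V) : R :=
  if s is v :: s' then 2^-1 * (savg s' F (a + v) + savg s' F (a - v)) else F a.

Lemma savg_le (V : zmodType) (s : seq V) (F G : V -> R) a :
  (forall x, F x <= G x) -> savg s F a <= savg s G a.
Proof.
move=> FG; elim: s a => [|v s IH] a //=.
by rewrite ler_pM2l ?invr_gt0// lerD.
Qed.

Lemma savgD (V : zmodType) (s : seq V) (F G : V -> R) a :
  savg s (fun x => F x + G x) a = savg s F a + savg s G a.
Proof. by elim: s a => [|v s IH] a //=; rewrite !IH; lra. Qed.

Lemma savgZ (V : zmodType) (s : seq V) (F : V -> R) c a :
  savg s (fun x => c * F x) a = c * savg s F a.
Proof. by elim: s a => [|v s IH] a //=; rewrite !IH; lra. Qed.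

Lemma savg_cst (V : zmodType) (s : seq V) c a : savg s (fun=> c) a = c.
Proof. by elim: s a => [|v s IH] a //=; rewrite !IH; lra. Qed.

Lemma savg_cat (V : zmodType) (s t : seq V) (F : V -> R) a :
  savg (s ++ t) F a = savg s (savg t F) a.
Proof. by elim: s a => [|v s IH] a //=; rewrite !IH. Qed.

Lemma savg_rcons (V : zmodType) (s : seq V) v (F : V -> R) a :
  savg (rcons s v) F a = savg (v :: s) F a.
Proof.
elim: s a => [|u s IH] a //.
rewrite rcons_cons /= !IH /=.
rewrite (addrAC a u v) (addrAC a u (- v)) (addrAC a (- u) v) (addrAC a (- u) (- v)).
by lra.
Qed.

Lemma savg_catC (V : zmodType) (s t : seq V) (F : V -> R) a :
  savg (s ++ t) F a = savg (t ++ s) F a.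
Proof.
elim: s a => [|v s IH] a; first by rewrite cats0.
rewrite cat_cons /= !IH -[LHS]/(savg (v :: t ++ s) F a) -savg_rcons rcons_cat.
rewrite !savg_cat; congr savg; apply/funext => x; exact: savg_rcons.
Qed.

(** Flipping all signs reflects the random sum in its centre. The induction moves two centres in
    opposite directions, which preserves [c + b]. *)
Lemma savg_sym (V : zmodType) (s : seq V) (F : V -> R) a :
  savg s F a = savg s (fun x => F (a + a - x)) a.
Proof.
suff H : forall b c, savg s F b = savg s (fun x => F (c + b - x)) c by exact: H.
elim: s => [|v s IH] b c /=; first by rewrite (addrC c) addrK.
rewrite (IH (b + v) (c - v)) (IH (b - v) (c + v)).
rewrite (addrACA c (- v)) addNr (addrACA c v) subrr !addr0.
by rewrite [X in _ * X = _]addrC.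
Qed.

Lemma savg_map (V W : zmodType) (phi : V -> W) (s : seq V) (F : W -> R) a :
  {morph phi : x y / x + y} -> {morph phi : x / - x} ->
  savg (map phi s) F (phi a) = savg s (F \o phi) a.
Proof.
move=> pD pN; elim: s a => [|v s IH] a //=.
by rewrite -!IH !pD pN.
Qed.

Lemma savg_norm (V : zmodType) (s : seq V) (F : V -> R) a :
  `|savg s F a| <= savg s (fun x => `|F x|) a.
Proof.
elim: s a => [|v s IH] a //=.
rewrite normrM ger0_norm ?invr_ge0// ler_pM2l ?invr_gt0//.
by rewrite (le_trans (ler_normD _ _))// lerD.
Qed.

End sign_average.

Section khintchine.
Context {R : realType}.

Lemma savg_sqr (s : seq R) a :
  savg s (fun x => x ^+ 2) a = a ^+ 2 + \sum_(v <- s) v ^+ 2.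
Proof.
elim: s a => [|v s IH] a /=; first by rewrite big_nil addr0.
by rewrite !IH big_cons; lra.
Qed.

(** The centre is kept general for the induction, each step of which loses only [2 v^4]. At [a = 0]
    this is the Gaussian comparison: the fourth moment is at most three times the squared second
    moment. *)
Lemma savg_four (s : seq R) a :
  savg s (fun x => x ^+ 4) a <=
  a ^+ 4 + 6 * a ^+ 2 * (\sum_(v <- s) v ^+ 2) + 3 * (\sum_(v <- s) v ^+ 2) ^+ 2.
Proof.
elim: s a => [|v s IH] a /=; first by rewrite big_nil; lra.
rewrite big_cons; set q := \sum_(_ <- _) _ in IH *.
have := IH (a + v); have := IH (a - v) => H1 H2.
have v4 : 0 <= v ^+ 4 by apply: exprn_even_ge0.
by nra.
Qed.

(** Fourth-moment method: with [z^2] the second moment, averaging the tangent bound below gives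
    [16 z^3 E|x| >= 12 z^4 - 3 z^4], that is [E|x| >= (9/16) z], and the factor 2 absorbs 16/9. *)
Lemma khintchine (s : seq R) :
  Num.sqrt (\sum_(v <- s) v ^+ 2) <= 2 * savg s (fun x => `|x|) 0.
Proof.
set q := \sum_(_ <- _) _.
have q0 : 0 <= q by apply: sumr_ge0 => v _; exact: sqr_ge0.
move: q0; rewrite le_eqVlt => /orP[/eqP<-|q0].
  rewrite sqrtr0 mulr_ge0//; apply: (le_trans (normr_ge0 _)).
  exact: (@savg_norm _ _ s (@idfun R) 0).
have s0 : 0 < Num.sqrt q by rewrite sqrtr_gt0.
have qE : q = Num.sqrt q ^+ 2 by rewrite sqr_sqrtr// ltW.
set z := Num.sqrt q in s0 qE *.
have := savg_sqr s 0; have := savg_four s 0.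
rewrite -/q qE => E4 E2.
(* the tangent bound 2 t^3 |x| >= 3 t^2 x^2 - x^4 at t = 2 z *)
have : savg s (fun x => 12 * z ^+ 2 * x ^+ 2 + (-1) * x ^+ 4) 0 <=
       savg s (fun x => 16 * z ^+ 3 * `|x|) 0.
  apply: savg_le => x; rewrite -subr_ge0.
  have -> : 16 * z ^+ 3 * `|x| - (12 * z ^+ 2 * x ^+ 2 + -1 * x ^+ 4) =
     `|x| * ((`|x| - 2 * z) ^+ 2 * (`|x| + 4 * z)).
    rewrite -(real_normK (num_real x)) (_ : x ^+ 4 = `|x| ^+ 4); first by ring.
    by rewrite -normrX ger0_norm// exprn_even_ge0.
  apply: mulr_ge0 => //; apply: mulr_ge0; first exact: sqr_ge0.
  by apply: addr_ge0 => //; rewrite mulr_ge0// ltW.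
rewrite savgD !savgZ E2 => H.
have z3 : 0 < z ^+ 3 by rewrite exprn_gt0.
rewrite -(ler_pM2l z3).
have z4 : 0 < z ^+ 3 * z by rewrite mulr_gt0.
by move: E4 H; lra.
Qed.

End khintchine.

Section contraction.
Context {R : realType}.

(* If the two maxima are attained at [k] and [k'], half their sum involves
   [f k - f k'] only, which Khintchine's inequality linearizes. *)
Lemma contraction_step N (a f : nat -> R) (l : seq (nat -> R)) :
  (forall k k', `|f k - f k'| <=
     Num.sqrt (\sum_(v <- l) (v k - v k') ^+ 2)) ->
  savg [:: f] (fmax N) a <= savg (map (fun v => (fun k => 2 * v k)) l) (fmax N) a.
Proof.
have fD (x y : nat -> R) j : (x + y) j = x j + y j by [].
have fN (x : nat -> R) j : (- x) j = - x j by [].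
move=> fl /=.
have [k kN ->] := fmax_attained N (a + f).
have [k' k'N ->] := fmax_attained N (a - f).
set l2 := map _ l.
(* Khintchine for the numbers [v k - v k']; its factor 2 is absorbed by the doubled functions in
   [l2]. *)
have H : f k - f k' <= savg l2 (fun x => `|x k - x k'|) 0.
  rewrite (le_trans (ler_norm _))// (le_trans (fl _ _))//.
  have := khintchine [seq v k - v k' | v <- l]; rewrite big_map => /le_trans; apply.
  rewrite -savgZ /l2.
  rewrite -(@savg_map _ _ _ (fun v : nat -> R => v k - v k') l2 (fun x => `|x|) 0)//=; last 2 first.
  - by move=> x y; rewrite !fD; ring.
  - by move=> x; rewrite !fN; ring.
  rewrite /l2 -map_comp.
  have -> : (0 : nat -> R) k - (0 : nat -> R) k' = 2 * 0 by rewrite mulr0 subrr.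
  have -> : [seq ((fun v : nat -> R => v k - v k') \o
      (fun (v : nat -> R) (i : nat) => 2 * v i)) v | v <- l] =
      [seq 2 * x | x <- [seq v k - v k' | v <- l]].
    by rewrite -map_comp; apply: eq_map => v /=; rewrite mulrBr.
  rewrite (@savg_map _ _ _ (fun x : R => 2 * x)); last 2 first.
  - by move=> x y; rewrite mulrDr.
  - by move=> x; rewrite mulrN.
  by apply: savg_le => x /=; rewrite normrM ger0_norm.
(* Pairing each sign pattern with its opposite gives two maxima; testing them at [k] and [k'], in
   either order, yields the absolute value that [H] needs. *)
have -> : savg l2 (fmax N) a = 2^-1 * savg l2 (fun x => fmax N x + fmax N (a + a - x)) a.
  by rewrite savgD -savg_sym; lra.
rewrite ler_pM2l ?invr_gt0//.
apply: (@le_trans _ _ (savg l2 (fun x => a k + a k' + `|x k - x k' - (a k - a k')|) a)).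
  rewrite savgD savg_cst.
  have : savg l2 (fun x => `|x k - x k' - (a k - a k')|) a =
         savg l2 (fun x => `|x k - x k'|) 0.
    have sh b : savg l2 (fun x => `|x k - x k' - (a k - a k')|) (b + a) =
         savg l2 (fun x => `|x k - x k'|) b.
      elim: (l2) b => [|v s IH] b /=.
        by congr `|_|; rewrite !fD; ring.
      by rewrite -!IH !(addrAC b a).
    by have := sh 0; rewrite add0r.
  move=> ->.
  move: H; set z := savg _ _ 0 => H.
  rewrite !fD !fN.
  by move: H; lra.
apply: savg_le => x.
have := le_fmax x kN; have := le_fmax x k'N.
have := le_fmax (a + a - x) kN; have := le_fmax (a + a - x) k'N.
rewrite !fD !fN /= => H1 H2 H3 H4.
by rewrite -lerBrDl ler_norml; apply/andP; split; lra.
Qed.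

(** One function is linearized at a time: for fixed values of the other signs, their contribution is
    part of the arbitrary centre, so [contraction_step] applies to the single remaining sign. *)
Lemma vector_contraction N (ls : seq ((nat -> R) * seq (nat -> R))) (a : nat -> R) :
  (forall p, p \in ls -> forall k k', `|p.1 k - p.1 k'| <=
     Num.sqrt (\sum_(v <- p.2) (v k - v k') ^+ 2)) ->
  savg (map fst ls) (fmax N) a <=
  savg (map (fun v => (fun k => 2 * v k)) (flatten (map snd ls))) (fmax N) a.
Proof.
elim: ls a => [|[f l] ls IH] a H //.
rewrite map_cons [flatten _]/= map_cat savg_cat.
apply: (@le_trans _ _
  (savg [:: f] (savg (map (fun v => (fun k => 2 * v k)) (flatten (map snd ls))) (fmax N)) a)).
  rewrite -cat1s savg_cat; apply: savg_le => x; apply: IH => p pls.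
  by apply: H; rewrite inE pls orbT.
(* Commuting the two blocks of signs makes the single sign of [f] the inner average. *)
rewrite -[leLHS]savg_cat -[leRHS]savg_cat savg_catC [leRHS]savg_catC !savg_cat.
apply: savg_le => x; apply: contraction_step.
by apply: (H (f, l)); rewrite inE eqxx.
Qed.

End contraction.

(** * Inner products and positive semidefinite matrices *)

Section dot_product.
Context {R : realType}.
Implicit Type m : nat.

Definition dot m (u v : 'rV[R]_m) : R := \sum_i u 0 i * v 0 i.

Lemma dotE m (u v : 'rV[R]_m) : dot u v = (u *m v^T) 0 0.
Proof. by rewrite mxE; apply: eq_bigr => i _; rewrite mxE. Qed.

Lemma dotC m (u v : 'rV[R]_m) : dot u v = dot v u.
Proof. by apply: eq_bigr => i _; rewrite mulrC. Qed.

Lemma dotDl m (u v w : 'rV[R]_m) : dot (u + v) w = dot u w + dot v w.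
Proof. by rewrite !dotE mulmxDl mxE. Qed.

Lemma dotZl m c (u w : 'rV[R]_m) : dot (c *: u) w = c * dot u w.
Proof. by rewrite !dotE -scalemxAl mxE. Qed.

Lemma dotNl m (u w : 'rV[R]_m) : dot (- u) w = - dot u w.
Proof. by rewrite -scaleN1r dotZl mulN1r. Qed.

Lemma dotDr m (u v w : 'rV[R]_m) : dot w (u + v) = dot w u + dot w v.
Proof. by rewrite dotC dotDl !(dotC w). Qed.

Lemma dotZr m c (u w : 'rV[R]_m) : dot w (c *: u) = c * dot w u.
Proof. by rewrite dotC dotZl dotC. Qed.

Lemma dotNr m (u w : 'rV[R]_m) : dot w (- u) = - dot w u.
Proof. by rewrite dotC dotNl dotC. Qed.

Lemma dot_ge0 m (u : 'rV[R]_m) : 0 <= dot u u.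
Proof. by apply: sumr_ge0 => i _; exact: sqr_ge0. Qed.

Lemma dot_mulmx m p (u : 'rV[R]_m) (A : 'M[R]_(m, p)) (v : 'rV[R]_p) :
  dot (u *m A) v = dot u (v *m A^T).
Proof. by rewrite !dotE trmx_mul trmxK mulmxA. Qed.

Lemma enorm_ge0 m (u : 'rV[R]_m) : 0 <= enorm u.
Proof. exact: sqrtr_ge0. Qed.

Lemma sqr_enorm m (u : 'rV[R]_m) : enorm u ^+ 2 = dot u u.
Proof.
rewrite sqr_sqrtr; last by apply: sumr_ge0 => i _; exact: sqr_ge0.
by apply: eq_bigr => i _; rewrite expr2.
Qed.

Lemma dot_eq0 m (u v : 'rV[R]_m) : dot u u = 0 -> dot u v = 0.
Proof.
move=> /eqP; rewrite psumr_eq0 => [/allP u0|i _]; last exact: sqr_ge0.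
rewrite /dot big1// => i _.
have := u0 i; rewrite mem_index_enum => /(_ isT)/=.
by rewrite mulf_eq0 orbb => /eqP->; rewrite mul0r.
Qed.

Lemma dot_CS m (u v : 'rV[R]_m) : dot u v ^+ 2 <= dot u u * dot v v.
Proof.
have [v0|v0] := eqVneq (dot v v) 0.
  by rewrite dotC (dot_eq0 _ v0) expr0n mulr_ge0// dot_ge0.
have vp : 0 < dot v v by rewrite lt_neqAle eq_sym v0 dot_ge0.
have := dot_ge0 (dot v v *: u - dot u v *: v).
rewrite !(dotDl, dotDr, dotNl, dotNr, dotZl, dotZr) (dotC v u) => H.
rewrite -subr_ge0 -(pmulr_rge0 _ vp).
by move: H; lra.
Qed.

Lemma dot_le_enorm m (u v : 'rV[R]_m) : dot u v <= enorm u * enorm v.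
Proof.
rewrite (le_trans (ler_norm _))// -(ler_pXn2r (n := 2))// ?nnegrE ?mulr_ge0 ?enorm_ge0//.
by rewrite exprMn !sqr_enorm real_normK ?num_real// dot_CS.
Qed.

End dot_product.

Section psd_factorization.
Context {R : realType}.
Implicit Type m : nat.

Lemma psdP m (M : 'M[R]_m) : psd M ->
  M^T = M /\ forall v : 'rV[R]_m, 0 <= dot (v *m M) v.
Proof.
move=> [MT M0]; split=> // v.
by have := M0 v^T; rewrite trmxK dotE.
Qed.

(* One step of symmetric Gaussian elimination; iterating over [k] writes a
   positive semidefinite matrix as a sum of rank-one ones without diagonalizing it. *)
Lemma psd_eliminate m (M : 'M[R]_m) (k : 'I_m) :
  psd M -> (forall i j : 'I_m, (i < k)%N -> M i j = 0) ->
  exists2 a : 'rV[R]_m, psd (M - a^T *m a) &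
    forall i j : 'I_m, (i <= k)%N -> (M - a^T *m a) i j = 0.
Proof.
move=> Mpsd M0; have [MT Mq] := psdP Mpsd.
have sym i j : M i j = M j i by rewrite -{1}MT mxE.
pose e (j : 'I_m) : 'rV[R]_m := delta_mx 0 j.
have eM j v : dot (e j *m M) v = dot (row j M) v by rewrite rowE.
have Me v j : dot v (e j) = v 0 j.
  rewrite /dot (bigD1 j)//= big1 ?addr0 ?mxE ?eqxx ?mulr1//.
  by move=> i ij; rewrite mxE eq_sym (negbTE (_ : j != i)) ?andbF ?mulr0// eq_sym.
have Mv v j : dot (v *m M) (e j) = dot (row j M) v.
  by rewrite dot_mulmx MT dotC eM.
have quad v t j : 0 <= dot (v *m M) v + 2 * t * dot (row j M) v + t ^+ 2 * M j j.
  have := Mq (v + t *: e j).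
  rewrite mulmxDl -scalemxAl !(dotDl, dotDr, dotZl, dotZr) !eM Mv Me mxE; lra.
have [Mk|Mk] := eqVneq (M k k) 0.
  have Mkj j : M k j = 0.
    apply/eqP/negP => /negP c.
    (* With a zero pivot the form is affine in [t]; a nonzero slope [M k j] would let this [t] reach
       the negative value [- M j j - 2]. *)
    have := quad (e j) (- (M j j + 1) / M k j) k; rewrite eM !Me !mxE Mk.
    have -> : 2 * (- (M j j + 1) / M k j) * M k j = - 2 * (M j j + 1) by field.
    have := quad 0 1 j; rewrite mul0mx !dotE mul0mx trmx0 mulmx0 !mxE; lra.
  exists 0; rewrite ?mulmx0 ?subr0// => i j.
  by rewrite leq_eqVlt => /orP[/eqP/val_inj->|/M0].
have Mkp : 0 < M k k.
  rewrite lt_neqAle eq_sym Mk/=.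
  by have := quad 0 1 k; rewrite mul0mx !dotE mul0mx trmx0 mulmx0 !mxE; lra.
have s2 : (Num.sqrt (M k k))^-1 ^+ 2 = (M k k)^-1.
  by rewrite exprVn sqr_sqrtr// ltW.
(* The remainder is the Schur complement of the pivot. Its form at [v] is the minimum over [t] of
   the quadratic in [quad], attained at [- p / M k k]. *)
exists ((Num.sqrt (M k k))^-1 *: row k M).
  split; first by rewrite linearB/= trmx_mul trmxK MT.
  move=> v; set a := _ *: _.
  have -> : (v^T *m (M - a^T *m a) *m v) 0 0 = dot (v^T *m M) v^T - dot v^T a ^+ 2.
    rewrite mulmxBr mulmxBl mxE dotE trmxK; congr (_ + _); rewrite mxE; congr (- _).
    by rewrite mulmxA -mulmxA mxE big_ord1 expr2 {1}dotE dotC dotE trmxK.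
  rewrite /a dotZr (dotC _ (row k M)) exprMn s2.
  have := quad v^T (- (dot (row k M) v^T / M k k)) k.
  set q := dot (_ *m _) _; set p := dot _ _ => H.
  suff -> : q - (M k k)^-1 * p ^+ 2 =
    q + 2 * - (p / M k k) * p + (- (p / M k k)) ^+ 2 * M k k by [].
  by field.
move=> i j; rewrite !mxE big_ord1 !mxE mulrACA -expr2 s2.
rewrite leq_eqVlt => /orP[/eqP/val_inj->|ik].
  by rewrite mulrA mulVf// mul1r subrr.
by rewrite (sym k i) (M0 i k)// (M0 i j)// mul0r mulr0 subrr.
Qed.

Lemma psd_sum_rank1 m (M : 'M[R]_m) : psd M ->
  exists s : seq 'rV[R]_m, M = \sum_(a <- s) a^T *m a.
Proof.
move=> Mpsd.
have elim p : (p <= m)%N -> exists s : seq 'rV[R]_m, exists M',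
    [/\ M = M' + \sum_(a <- s) a^T *m a, psd M' &
      forall i j : 'I_m, (i < p)%N -> M' i j = 0]; last first.
  have [s [M' [e M'psd M'0]]] := elim m (leqnn m).
  exists s; rewrite {1}e (_ : M' = 0) ?add0r//.
  by apply/matrixP => i j; rewrite M'0// mxE.
elim: p => [_|p IH pm]; first by exists [::], M; split => //; rewrite big_nil addr0.
have [s [M' [e M'psd M'0]]] := IH (ltnW pm).
have [a ap a0] := psd_eliminate (k := Ordinal pm) M'psd M'0.
exists (a :: s), (M' - a^T *m a); split => //.
by rewrite big_cons addrA subrK.
Qed.

Lemma trace_rank1 m (s : seq 'rV[R]_m) :
  \tr (\sum_(a <- s) a^T *m a) = \sum_(a <- s) dot a a.
Proof.
rewrite raddf_sum/=; apply: eq_bigr => a _.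
by rewrite mxtrace_mulC /mxtrace big_ord1 dotE.
Qed.

Lemma form_rank1 m (s : seq 'rV[R]_m) v :
  dot (v *m (\sum_(a <- s) a^T *m a)) v = \sum_(a <- s) dot v a ^+ 2.
Proof.
rewrite mulmx_sumr dotE mulmx_suml summxE; apply: eq_bigr => a _.
by rewrite mulmxA -mulmxA mxE big_ord1 -!dotE (dotC a) expr2.
Qed.

End psd_factorization.

Section lipschitz_rademacher.
Context {R : realType}.

Lemma savg_jensen (V : zmodType) (s : seq V) (F : V -> R) a :
  savg s F a ^+ 2 <= savg s (fun x => F x ^+ 2) a.
Proof.
elim: s a => [|v s IH] a //=.
have := IH (a + v); have := IH (a - v).
have := sqr_ge0 (savg s F (a + v) - savg s F (a - v)); lra.
Qed.

Lemma savg_dot m (s : seq 'rV[R]_m) a :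
  savg s (fun x => enorm x ^+ 2) a = enorm a ^+ 2 + \sum_(v <- s) dot v v.
Proof.
elim: s a => [|v s IH] a /=; first by rewrite big_nil addr0.
rewrite !IH big_cons !sqr_enorm !(dotDl, dotDr, dotNl, dotNr); lra.
Qed.

(** Cauchy-Schwarz takes the maximum over the parameters out of the average; Jensen's inequality and
    the orthogonality of the signs leave the sum of squared norms, free of [m] and [N]. *)
Lemma linear_rademacher m N (w : nat -> 'rV[R]_m) (r : R) (s : seq 'rV[R]_m) :
  (forall k, enorm (w k) <= r) ->
  savg [seq (fun k => dot (w k) a) | a <- s] (fmax N) 0 <=
  r * Num.sqrt (\sum_(a <- s) dot a a).
Proof.
move=> wr; have r0 : 0 <= r := le_trans (enorm_ge0 _) (wr 0%N).
have -> : (0 : nat -> R) = (fun k => dot (w k) 0).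
  by apply/funext => k; rewrite dotE trmx0 mulmx0 mxE.
rewrite (savg_map s (fmax N) 0 (phi := fun a k => dot (w k) a)); last 2 first.
- by move=> x y; apply/funext => k; rewrite dotDr.
- by move=> x; apply/funext => k; rewrite dotNr.
apply: (@le_trans _ _ (savg s (fun x => r * enorm x) 0)).
  apply: savg_le => x; apply: fmax_le => k _.
  by rewrite (le_trans (dot_le_enorm _ _))// ler_wpM2r// enorm_ge0.
rewrite savgZ ler_wpM2l//.
rewrite (le_trans (ler_norm _))// -sqrtr_sqr ler_wsqrtr//.
rewrite (le_trans (savg_jensen _ _ _))// savg_dot sqr_enorm.
by rewrite dotE mul0mx mxE add0r.
Qed.

Lemma lipschitz_rademacher m N n (w : nat -> 'rV[R]_m) (r : R)
    (f : 'I_n -> nat -> R) (M : 'I_n -> 'M[R]_m) :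
  (forall k, enorm (w k) <= r) -> (forall j, psd (M j)) ->
  (forall j k k', (f j k - f j k') ^+ 2 <= dot ((w k - w k') *m M j) (w k - w k')) ->
  savg [seq f j | j <- enum 'I_n] (fmax N) 0 <=
  2 * r * Num.sqrt (\sum_j \tr (M j)).
Proof.
move=> wr Mpsd fM.
have [s sM] : {s : 'I_n -> seq 'rV[R]_m & forall j, M j = \sum_(a <- s j) a^T *m a}.
  by apply: (@boolp.choice _ _ (fun j s => M j = \sum_(a <- s) a^T *m a)) => j; exact: psd_sum_rank1.
pose lin (a : 'rV[R]_m) : nat -> R := fun k => dot (w k) a.
have := @vector_contraction _ N [seq (f j, map lin (s j)) | j <- enum 'I_n] 0.
rewrite -[X in savg X _ _ <= _]map_comp => /(_ _)/le_trans; apply.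
  move=> p /mapP[j _ ->] k k' /=; rewrite big_map -sqrtr_sqr ler_wsqrtr//.
  rewrite (le_trans (fM _ _ _))// sM form_rank1; apply: ler_sum => a _.
  by rewrite /lin dotDl dotNl.
set u := [seq _ | v <- _].
(* The factor 2 of the contraction is moved onto the parameters, which then have norm at most
   [2 * r]. *)
have -> : u = [seq (fun k => dot (2 *: w k) a) | a <- flatten [seq s j | j <- enum 'I_n]].
  rewrite /u.
  elim: (enum 'I_n) => //= j l IH; rewrite !map_cat IH; congr (_ ++ _).
  rewrite -map_comp; apply: eq_map => a; apply/funext => k /=.
  by rewrite dotZl.
apply: (@le_trans _ _ ((2 * r) *
    Num.sqrt (\sum_(a <- flatten [seq s j | j <- enum 'I_n]) dot a a))).
  apply: linear_rademacher => k.
  rewrite -(ler_pXn2r (n := 2))// ?nnegrE ?enorm_ge0//; last first.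
    by rewrite mulr_ge0// (le_trans _ (wr 0%N))// enorm_ge0.
  rewrite sqr_enorm dotZl dotZr -sqr_enorm.
  have := wr k; have := enorm_ge0 (w k); nra.
rewrite big_flatten/= big_map big_enum/=.
by under eq_bigr do rewrite -trace_rank1 -sM.
Qed.

End lipschitz_rademacher.

(** * Concentration and symmetrization for i.i.d. samples *)

Section bounded_measurable.
Context {R : realType}.

(** A class closed under every operation performed on samples below, in which integrability and
    Fubini's theorem come for free. The gaps lie in it because they are bounded by [s^2 B]. *)
Definition bmeas d (T : measurableType d) (f : T -> R) :=
  measurable_fun setT f /\ exists K : R, forall x, `|f x| <= K.

Lemma bmeas_cst d (T : measurableType d) (c : R) : bmeas (fun _ : T => c).
Proof. by split => //; exists `|c|. Qed.

Lemma bmeasD d (T : measurableType d) (f g : T -> R) :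
  bmeas f -> bmeas g -> bmeas (fun x => f x + g x).
Proof.
move=> [mf [K Kf]] [mg [M Mg]]; split; first exact: measurable_funD.
by exists (K + M) => x; rewrite (le_trans (ler_normD _ _))// lerD.
Qed.

Lemma bmeasN d (T : measurableType d) (f : T -> R) :
  bmeas f -> bmeas (fun x => - f x).
Proof.
move=> [mf [K Kf]]; split; first exact: measurableT_comp.
by exists K => x; rewrite normrN.
Qed.

Lemma bmeasB d (T : measurableType d) (f g : T -> R) :
  bmeas f -> bmeas g -> bmeas (fun x => f x - g x).
Proof. by move=> bf bg; apply: bmeasD => //; exact: bmeasN. Qed.

Lemma bmeasZ d (T : measurableType d) (c : R) (f : T -> R) :
  bmeas f -> bmeas (fun x => c * f x).
Proof.
move=> [mf [K Kf]]; split; first exact: measurable_funM.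
by exists (`|c| * K) => x; rewrite normrM ler_wpM2l.
Qed.

Lemma bmeas_sum d (T : measurableType d) (I : Type) (s : seq I) (f : I -> T -> R) :
  (forall i, bmeas (f i)) -> bmeas (fun x => \sum_(i <- s) f i x).
Proof.
move=> bf; elim: s => [|i s IH].
  by under eq_fun do rewrite big_nil; exact: bmeas_cst.
by under eq_fun do rewrite big_cons; exact: bmeasD.
Qed.

Lemma bmeas_max d (T : measurableType d) (f g : T -> R) :
  bmeas f -> bmeas g -> bmeas (fun x => Num.max (f x) (g x)).
Proof.
move=> [mf [K Kf]] [mg [M Mg]]; split; first exact: measurable_maxr.
exists (Num.max K M) => x.
case: (leP (f x) (g x)) => _; first by rewrite le_max Mg orbT.
by rewrite le_max Kf.
Qed.

Lemma bmeas_expR d (T : measurableType d) (f : T -> R) :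
  bmeas f -> bmeas (fun x => expR (f x)).
Proof.
move=> [mf [K Kf]]; split; first exact: measurableT_comp.
exists (expR K) => x; rewrite ger0_norm ?expR_ge0// ler_expR.
by rewrite (le_trans (ler_norm _)).
Qed.

Lemma bmeas_comp d d' (T : measurableType d) (U : measurableType d')
    (f : U -> R) (g : T -> U) :
  bmeas f -> measurable_fun setT g -> bmeas (fun x => f (g x)).
Proof.
by move=> [mf [K Kf]] mg; split; [exact: measurableT_comp|exists K].
Qed.

Lemma bmeas_pair1 d1 d2 (T1 : measurableType d1) (T2 : measurableType d2)
    (F : T1 * T2 -> R) (y : T2) : bmeas F -> bmeas (fun x => F (x, y)).
Proof. by move=> [mF [K FK]]; split; [exact: measurable_fun_pair1|exists K]. Qed.

Lemma bmeas_pair2 d1 d2 (T1 : measurableType d1) (T2 : measurableType d2)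
    (F : T1 * T2 -> R) (x : T1) : bmeas F -> bmeas (fun y => F (x, y)).
Proof. by move=> [mF [K FK]]; split; [exact: measurable_fun_pair2|exists K]. Qed.

Section expectation.
Context d (T : measurableType d) (P : probability T R).

Lemma bmeas_integrable (f : T -> R) : bmeas f -> P.-integrable setT (EFin \o f).
Proof.
move=> [mf [K Kf]]; apply: measurable_bounded_integrable => //.
  by rewrite (le_lt_trans (probability_le1 P measurableT))// ltry.
exists K; split; first exact: num_real.
by move=> M KM x _ /=; apply: le_trans (Kf x) _; exact: ltW.
Qed.

Lemma EFin_Rintegral (f : T -> R) : P.-integrable setT (EFin \o f) ->
  (\int[P]_x f x)%:E = (\int[P]_x (f x)%:E)%E.
Proof. by move=> fi; rewrite fineK//; exact: integrable_fin_num. Qed.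

Lemma Rint_cst (c : R) : \int[P]_x c = c.
Proof. by rewrite Rintegral_cst// [X in fine X](probability_setT P) mulr1. Qed.

Lemma le_Rint (f g : T -> R) : bmeas f -> bmeas g -> (forall x, f x <= g x) ->
  \int[P]_x f x <= \int[P]_x g x.
Proof. by move=> bf bg fg; apply: le_Rintegral => //; exact: bmeas_integrable. Qed.

Lemma RintD (f g : T -> R) : bmeas f -> bmeas g ->
  \int[P]_x (f x + g x) = \int[P]_x f x + \int[P]_x g x.
Proof. by move=> bf bg; rewrite RintegralD//; exact: bmeas_integrable. Qed.

Lemma RintB (f g : T -> R) : bmeas f -> bmeas g ->
  \int[P]_x (f x - g x) = \int[P]_x f x - \int[P]_x g x.
Proof. by move=> bf bg; rewrite RintegralB//; exact: bmeas_integrable. Qed.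

Lemma RintZ (c : R) (f : T -> R) : bmeas f ->
  \int[P]_x (c * f x) = c * \int[P]_x f x.
Proof. by move=> bf; rewrite RintegralZl//; exact: bmeas_integrable. Qed.

Lemma Rint_norm_le (f : T -> R) (K : R) : measurable_fun setT f ->
  (forall x, `|f x| <= K) -> `|\int[P]_x f x| <= K.
Proof.
move=> mf fK; have bf : bmeas f by split => //; exists K.
rewrite ler_norml -(Rint_cst K) -(Rint_cst (- \int[P]_x K)).
apply/andP; split; apply: le_Rint => //; try exact: bmeas_cst.
  by move=> x; rewrite Rint_cst; have := fK x; rewrite ler_norml => /andP[].
by move=> x; rewrite (le_trans (ler_norm _)).
Qed.

End expectation.

Section fubini.
Context d1 d2 (T1 : measurableType d1) (T2 : measurableType d2).
Context (P1 : probability T1 R) (P2 : probability T2 R).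

Lemma bmeas_Rint2 (F : T1 * T2 -> R) : bmeas F ->
  bmeas (fun x => \int[P2]_y F (x, y)).
Proof.
move=> [mF [K FK]].
have mFx x : measurable_fun setT (fun y => F (x, y)).
  exact: measurableT_comp.
have bFx x : bmeas (fun y => F (x, y)) by split => //; exists K.
split; last by exists K => x; exact: Rint_norm_le.
(* Tonelli measurability is about nonnegative integrands, so [F] is shifted by its bound [K]. *)
have -> : (fun x => \int[P2]_y F (x, y)) =
    (fun x => \int[P2]_y (F (x, y) + K) - K).
  by apply/funext => x; rewrite RintD//; [rewrite Rint_cst addrK|exact: bmeas_cst].
apply: measurable_funB => //; apply/measurable_EFinP.
have -> : (EFin \o (fun x => \int[P2]_y (F (x, y) + K))) =
    fubini_F P2 (fun z => (F z + K)%:E).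
  apply/funext => x /=; rewrite /fubini_F EFin_Rintegral//.
  by apply: bmeas_integrable; apply: bmeasD => //; exact: bmeas_cst.
apply: measurable_fun_fubini_tonelli_F.
  by apply/measurable_EFinP; apply: measurable_funD.
by move=> z; rewrite lee_fin; have := FK z; rewrite ler_norml => /andP[]; lra.
Qed.

Lemma Rint_prod (F : T1 * T2 -> R) : bmeas F ->
  \int[(P1 \x P2)%E]_z F z = \int[P1]_x \int[P2]_y F (x, y).
Proof.
move=> bF; have bF2 := bmeas_Rint2 bF.
have iF := bmeas_integrable (P1 \x P2)%E bF.
apply: EFin_inj; rewrite (EFin_Rintegral iF).
rewrite (EFin_Rintegral (bmeas_integrable _ bF2)).
rewrite -integral12_prod_meas1//; apply: eq_integral => x _.
rewrite /fubini_F EFin_Rintegral//; apply: bmeas_integrable.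
exact: bmeas_pair2.
Qed.

End fubini.

Lemma Rint_swap d1 d2 (T1 : measurableType d1) (T2 : measurableType d2)
    (P1 : probability T1 R) (P2 : probability T2 R) (F : T1 * T2 -> R) : bmeas F ->
  \int[P1]_x \int[P2]_y F (x, y) = \int[P2]_y \int[P1]_x F (x, y).
Proof.
move=> bF; have iF := bmeas_integrable (P1 \x P2)%E bF.
have bF' : bmeas (fun z : T2 * T1 => F (z.2, z.1)).
  by apply: (@bmeas_comp _ _ _ _ F) => //; exact: measurable_fun_pair.
apply: EFin_inj.
rewrite EFin_Rintegral; last exact/bmeas_integrable/bmeas_Rint2.
rewrite EFin_Rintegral; last exact/bmeas_integrable/(bmeas_Rint2 _ bF').
transitivity (\int[P1]_x \int[P2]_y (F (x, y))%:E)%E.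
  apply: eq_integral => x _; rewrite EFin_Rintegral//; apply: bmeas_integrable.
  exact: bmeas_pair2.
rewrite (Fubini iF); apply: eq_integral => y _.
rewrite EFin_Rintegral//; apply: bmeas_integrable.
exact: bmeas_pair1.
Qed.

End bounded_measurable.

(** * Exponential moments and bounded differences *)

Section hoeffding.
Context {R : realType}.

Lemma MVT_everywhere (f df : R -> R) (a b : R) : a <= b ->
  (forall x : R, is_derive x (1 : R) f (df x)) ->
  exists2 c, a <= c <= b & f b - f a = df c * (b - a).
Proof.
move=> ab fdf; have fc : {within `[a, b], continuous f}.
  apply: continuous_subspaceT => x; apply: differentiable_continuous.
  by apply/derivable1_diffP; apply: ex_derive.
have [c cab ->] := MVT_segment ab (fun x _ => fdf x) fc.
by exists c => //; move: cab; rewrite in_itv.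
Qed.

(** The function [p] below has derivative [- exp (- x^2 / 2) * g x], and [g] vanishes at 0 with
    derivative [x (e^x - e^(-x)) >= 0]. Hence [p x <= p 0 = 2] for [x >= 0]; evenness covers the
    other half-line. *)
Lemma cosh_le_gauss (x : R) : (expR x + expR (- x)) / 2 <= expR (x ^+ 2 / 2).
Proof.
wlog x0 : x / 0 <= x => [H|].
  have [|x0] := lerP 0 x; first exact: H.
  by rewrite -(sqrrN x) addrC -{2}(opprK x); apply: H; rewrite oppr_ge0 ltW.
pose g (x : R) := (x - 1) * expR x + (x + 1) * expR (- x).
have g_ge0 (y : R) : 0 <= y -> 0 <= g y.
  move=> y0; have [||c /andP[c0 _]] :=
      @MVT_everywhere g (fun x => x * (expR x - expR (- x))) 0 y => //.
    move=> z; rewrite /g; apply: is_derive_eq.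
    by rewrite /GRing.scale/=; ring.
  rewrite /g oppr0 !expR0 !addr0 => e.
  have -> : (y - 1) * expR y + (y + 1) * expR (- y) =
      c * (expR c - expR (- c)) * y by rewrite -e; ring.
  by rewrite !mulr_ge0// subr_ge0 ler_expR; lra.
pose p (x : R) := expR (- (x ^+ 2 / 2)) * (expR x + expR (- x)).
have [||c /andP[c0 _]] :=
    @MVT_everywhere p (fun x => - expR (- (x ^+ 2 / 2)) * g x) 0 x => //.
  move=> z; rewrite /p; apply: is_derive_eq.
  by rewrite /GRing.scale/= /g; field.
rewrite /p expr0n/= mul0r oppr0 !expR0 addr0 => e.
have : expR (- (x ^+ 2 / 2)) * (expR x + expR (- x)) <= 2.
  have : 0 <= expR (- (c ^+ 2 / 2)) * g c * x.
    by rewrite !mulr_ge0 ?expR_ge0// g_ge0.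
  by move: e; lra.
rewrite expRN mulrC ler_pdivrMr ?expR_gt0//; lra.
Qed.

Lemma expR_le_chord (c u : R) : 0 < c -> `|u| <= c -> forall t,
  expR (t * u) <= (expR (t * c) + expR (- (t * c))) / 2 +
                  u * ((expR (t * c) - expR (- (t * c))) / (2 * c)).
Proof.
move=> c0 uc t; move: uc; rewrite ler_norml => /andP[cu uc].
have s01 : 0 <= (c + u) / (2 * c) <= 1.
  apply/andP; split; first by rewrite divr_ge0; lra.
  by rewrite ler_pdivrMr; lra.
have := @convex_expR R (Itv01 (andP s01).1 (andP s01).2) (t * c) (- (t * c)).
rewrite !convRE/= /unstable.onem.
have -> : (c + u) / (2 * c) * (t * c) + (1 - (c + u) / (2 * c)) * - (t * c) = t * u.
  by field; lra.
move=> /le_trans; apply; rewrite le_eqVlt; apply/orP; left; apply/eqP.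
by field; lra.
Qed.

(** The chord bound on [[-c, c]] averages to [cosh (t c)] because [f] is centred. The case [c <= 0],
    in which [f] vanishes, is separate since the slope of the chord has denominator [2 c]. *)
Lemma hoeffding d (T : measurableType d) (P : probability T R) (f : T -> R)
    (c t : R) : measurable_fun setT f -> (forall x, `|f x| <= c) ->
  \int[P]_x f x = 0 ->
  \int[P]_x expR (t * f x) <= expR (t ^+ 2 * c ^+ 2 / 2).
Proof.
move=> mf fc f0; have bf : bmeas f by split => //; exists c.
have [c0|c0] := lerP c 0.
  have -> : (fun x => expR (t * f x)) = (fun _ => 1).
    apply/funext => x; have /eqP : f x == 0.
      by rewrite -normr_eq0 eq_le normr_ge0 (le_trans (fc x)).
    by move=> ->; rewrite mulr0 expR0.
  rewrite Rint_cst -expR0 ler_expR.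
  by rewrite divr_ge0// mulr_ge0// sqr_ge0.
apply: (@le_trans _ _ ((expR (t * c) + expR (- (t * c))) / 2)); last first.
  by rewrite -exprMn; exact: cosh_le_gauss.
set K := (_ / 2); set a := (expR (t * c) - expR (- (t * c))) / (2 * c).
apply: (@le_trans _ _ (\int[P]_x (K + a * f x))).
  apply: le_Rint.
  - by apply: bmeas_expR; exact: bmeasZ.
  - by apply: bmeasD; [exact: bmeas_cst|exact: bmeasZ].
  - by move=> x; rewrite (mulrC a); exact: expR_le_chord.
rewrite RintD; [|exact: bmeas_cst|exact: bmeasZ].
by rewrite Rint_cst RintZ// f0 mulr0 addr0.
Qed.

End hoeffding.

Section iid.
Context {R : realType} d (T : measurableType d) (P : probability T R).

Lemma bmeas_cons n (F : n.+1.-tuple T -> R) : bmeas F ->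
  bmeas (fun p : T * n.-tuple T => F (tuple_cons p)).
Proof. by move=> bF; apply: (bmeas_comp bF); exact: measurable_tuple_cons. Qed.

Lemma Rint_iid_cons n (F : n.+1.-tuple T -> R) : bmeas F ->
  \int[iid_prob P n.+1]_S F S =
  \int[P]_x \int[iid_prob P n]_S F (tuple_cons (x, S)).
Proof.
move=> bF; have bFc := bmeas_cons bF.
rewrite -(Rint_prod P (iid_prob P n) bFc); apply: EFin_inj.
rewrite (EFin_Rintegral (bmeas_integrable _ bF)).
rewrite (EFin_Rintegral (bmeas_integrable (P \x iid_prob P n)%E bFc)).
rewrite [LHS](_ : _ =
  (\int[pushforward (P \x iid_prob P n)%E (@tuple_cons _ T n)]_S (F S)%:E)%E)//.
have mF : measurable_fun setT (EFin \o F) by apply/measurable_EFinP; case: bF.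
rewrite (integral_pushforward (@measurable_tuple_cons _ T n) mF)//=.
by rewrite preimage_setT; exact: bmeas_integrable.
Qed.

Definition bounded_diff n (c : R) (F : n.-tuple T -> R) :=
  forall (S S' : n.-tuple T) (j : 'I_n),
    (forall k, k != j -> tnth S k = tnth S' k) -> `|F S - F S'| <= c.

(** Instead of a martingale, an induction that integrates the first coordinate last: given its
    value, the induction hypothesis controls the deviation from the conditional mean [F1], and
    Hoeffding's lemma controls [F1 - m], a centred function of one variable. *)
Lemma mcdiarmid_mgf n (c t : R) (F : n.-tuple T -> R) :
  0 <= c -> bmeas F -> bounded_diff c F ->
  \int[iid_prob P n]_S expR (t * (F S - \int[iid_prob P n]_S' F S')) <=
  expR (t ^+ 2 * c ^+ 2 / 2) ^+ n.
Proof.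
move=> c0; elim: n F => [|n IH] F bF dF.
  have FE S : F S = F [tuple] by rewrite tuple0.
  under eq_fun do rewrite FE.
  under [X in t * (_ - X)]eq_Rintegral do rewrite FE.
  by rewrite !Rint_cst subrr mulr0 expR0.
have bFc := bmeas_cons bF.
set m := \int[iid_prob P n.+1]_S' F S'.
pose F1 x := \int[iid_prob P n]_S F (tuple_cons (x, S)).
have bF1 : bmeas F1 by exact: bmeas_Rint2 bFc.
have mE : m = \int[P]_x F1 x by rewrite /m Rint_iid_cons.
rewrite Rint_iid_cons; last first.
  by apply: bmeas_expR; apply: bmeasZ; apply: bmeasB => //; exact: bmeas_cst.
set K := expR _.
have K0 : 0 <= K by exact: expR_ge0.
have bFx x : bmeas (fun S => F (tuple_cons (x, S))) := bmeas_pair2 x bFc.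
apply: (@le_trans _ _ (\int[P]_x (K ^+ n * expR (t * (F1 x - m))))).
  apply: le_Rint.
  - apply: (@bmeas_Rint2 _ _ _ _ _ _ (fun p => expR (t * (F (tuple_cons p) - m)))).
    by apply: bmeas_expR; apply: bmeasZ; apply: bmeasB => //; exact: bmeas_cst.
  - apply: bmeasZ; apply: bmeas_expR; apply: bmeasZ; apply: bmeasB => //.
    exact: bmeas_cst.
  move=> x.
  have -> : (fun S => expR (t * (F (tuple_cons (x, S)) - m))) =
     (fun S => expR (t * (F1 x - m)) * expR (t * (F (tuple_cons (x, S)) - F1 x))).
    by apply/funext => S; rewrite -expRD; congr expR; ring.
  rewrite RintZ; last first.
    apply: bmeas_expR; apply: bmeasZ; apply: bmeasB => //; exact: bmeas_cst.
  rewrite mulrC ler_wpM2r ?expR_ge0//.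
  apply: IH => // S S' j SS'; apply: (dF _ _ (lift ord0 j)) => k.
  case: (unliftP ord0 k) => [k' ->|->] kj; last by rewrite !tnth0.
  by rewrite !tnthS SS'//; apply: contra_neq kj => ->.
rewrite RintZ; last first.
  by apply: bmeas_expR; apply: bmeasZ; apply: bmeasB => //; exact: bmeas_cst.
rewrite exprSr ler_wpM2l ?exprn_ge0//.
apply: hoeffding.
- by case: (bmeasB bF1 (bmeas_cst T m)).
(* [F1 x - m] is the mean over [y] of [F1 x - F1 y], which compares samples differing in the first
   coordinate only. *)
- move=> x; rewrite mE -{1}(Rint_cst P (F1 x)) -RintB//; last exact: bmeas_cst.
  apply: Rint_norm_le; first by case: (bmeasB (bmeas_cst T (F1 x)) bF1).
  move=> y; rewrite -RintB//.
  apply: Rint_norm_le; first by case: (bmeasB (bFx x) (bFx y)).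
  move=> S; apply: (dF _ _ ord0) => k.
  by case: (unliftP ord0 k) => [k' ->|->]; rewrite ?eqxx// !tnthS.
- by rewrite RintB ?Rint_cst//; [rewrite mE subrr|exact: bmeas_cst].
Qed.

Lemma mcdiarmid n (c e : R) (F : n.-tuple T -> R) :
  (0 < n)%N -> 0 < c -> 0 <= e -> bmeas F -> bounded_diff c F ->
  \int[iid_prob P n]_S F S <= 0 ->
  (iid_prob P n [set S | (e <= F S)%R] <= (expR (- (e ^+ 2 / (2 * n%:R * c ^+ 2))))%:E)%E.
Proof.
move=> n0 c0 e0 bF dF F0.
have nR : 0 < n%:R :> R by rewrite ltr0n.
(* This [t] minimizes [n t^2 c^2 / 2 - t e]; the minimum is [- e^2 / (2 n c^2)]. *)
pose t := e / (n%:R * c ^+ 2).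
have t0 : 0 <= t by rewrite divr_ge0// mulr_ge0// sqr_ge0.
pose G S := expR (t * (F S - \int[iid_prob P n]_S' F S') - t * e).
have bG : bmeas G.
  apply: bmeas_expR; apply: bmeasB; last exact: bmeas_cst.
  by apply: bmeasZ; apply: bmeasB => //; exact: bmeas_cst.
have mE : measurable [set S | (e <= F S)%R].
  rewrite -[X in measurable X]setTI.
  by apply: (measurable_fun_le (f := cst e) (g := F)) => //; case: bF.
apply: (@le_trans _ _ (\int[iid_prob P n]_S (G S)%:E)%E).
  rewrite -[X in (X <= _)%E]mul1e -integral_cst//.
  apply: (@le_trans _ _ (\int[iid_prob P n]_(S in [set S | (e <= F S)%R]) (G S)%:E)%E).
    apply: ge0_le_integral => //.
    - apply/measurable_EFinP; apply: measurable_funTS; exact: bG.1.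
    - move=> S /= eF; rewrite lee_fin -[leLHS]expR0 ler_expR.
      by rewrite -mulrBr mulr_ge0//; lra.
  apply: ge0_subset_integral => //.
  - apply/measurable_EFinP; exact: bG.1.
  - by move=> S _; rewrite lee_fin expR_ge0.
rewrite -EFin_Rintegral ?bmeas_integrable// lee_fin.
have -> : G = fun S => expR (- (t * e)) * expR (t * (F S - \int[iid_prob P n]_S' F S')).
  by apply/funext => S; rewrite -expRD addrC.
rewrite RintZ; last first.
  by apply: bmeas_expR; apply: bmeasZ; apply: bmeasB => //; exact: bmeas_cst.
apply: (@le_trans _ _ (expR (- (t * e)) * expR (t ^+ 2 * c ^+ 2 / 2) ^+ n)).
  by rewrite ler_wpM2l ?expR_ge0// mcdiarmid_mgf// ltW.
rewrite -expRM_natl -expRD ler_expR le_eqVlt; apply/orP; left; apply/eqP.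
by rewrite /t; field; rewrite !gt_eqF.
Qed.

End iid.

(** * Symmetrization and the deviation at a single scale *)

Section symmetrization.
Context {R : realType} d (T : measurableType d) (P : probability T R).
Variable N : nat.

Lemma bmeas_fmax d' (Z : measurableType d') (A : Z -> nat -> R) :
  (forall k, bmeas (A^~ k)) -> bmeas (fun z => fmax N (A z)).
Proof.
move=> bA; elim: N => [|N' IH] /=; first exact: bA.
exact: bmeas_max.
Qed.

Lemma bmeas_savg d' (Z : measurableType d') (I : Type) (s : seq I)
    (l : I -> Z -> nat -> R) (A : Z -> nat -> R) :
  (forall i k, bmeas (fun z => l i z k)) -> (forall k, bmeas (A^~ k)) ->
  bmeas (fun z => savg [seq l i z | i <- s] (fmax N) (A z)).
Proof.
move=> bl; elim: s A => [|i s IH] A bA /=; first exact: bmeas_fmax.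
apply: bmeasZ; apply: bmeasD; apply: IH => k.
  exact: bmeasD.
exact: bmeasB.
Qed.

Variables (g : nat -> T -> R) (M : R).
Hypothesis g_meas : forall k, measurable_fun setT (g k).
Hypothesis g_bound : forall k x, `|g k x| <= M.

Let bg k : bmeas (g k).
Proof. by split => //; exists M. Qed.

Let e k := \int[P]_x g k x.

Lemma fmax_mean (b : nat -> R) :
  fmax N (fun k => b k + 2 * e k) <= \int[P]_x fmax N (fun k => b k + 2 * g k x).
Proof.
apply: fmax_le => k kN.
have -> : b k + 2 * e k = \int[P]_x (b k + 2 * g k x).
  by rewrite RintD ?Rint_cst ?RintZ//; [exact: bmeas_cst|exact: bmeasZ].
apply: le_Rint.
- by apply: bmeasD; [exact: bmeas_cst|exact: bmeasZ].
- by apply: bmeas_fmax => j; apply: bmeasD; [exact: bmeas_cst|exact: bmeasZ].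
- by move=> x; exact: (le_fmax (fun k => b k + 2 * g k x)).
Qed.

Let bmeas_shift (c : R) (b : nat -> R) :
  bmeas (fun x => fmax N (fun k => b k + c * g k x)).
Proof.
by apply: bmeas_fmax => k; apply: bmeasD; [exact: bmeas_cst|exact: bmeasZ].
Qed.

(** [fmax_half] separates [e] from [g], and [fmax_mean] then trades [e] for a sampled value. The
    right-hand side is the average over one sign of the maxima of [b + 2 g] and [b - 2 g], exactly
    what one entry of [savg] contributes. *)
Lemma symmetrization_step (b : nat -> R) :
  \int[P]_x fmax N (fun k => b k + (e k - g k x)) <=
  \int[P]_x (2^-1 * fmax N (fun k => b k + 2 * g k x) +
             2^-1 * fmax N (fun k => b k + (- 2) * g k x)).
Proof.
apply: (@le_trans _ _ (\int[P]_x (2^-1 * fmax N (fun k => b k + 2 * e k) +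
    2^-1 * fmax N (fun k => b k + (- 2) * g k x)))).
  apply: le_Rint.
  - apply: bmeas_fmax => k; apply: bmeasD; first exact: bmeas_cst.
    by apply: bmeasB => //; exact: bmeas_cst.
  - apply: bmeasD; first exact: bmeas_cst.
    by apply: bmeasZ; exact: bmeas_shift.
  - move=> x.
    rewrite (_ : (fun k => b k + (e k - g k x)) = (fun k => b k + e k - g k x)).
      rewrite (_ : (fun k => b k + - 2 * g k x) = (fun k => b k - 2 * g k x)).
        exact: fmax_half.
      by apply/funext => k; rewrite mulNr.
    by apply/funext => k; rewrite addrA.
rewrite !RintD; try (apply: bmeasZ; exact: bmeas_shift); last exact: bmeas_cst.
rewrite Rint_cst lerD2r RintZ; last exact: bmeas_shift.
by rewrite ler_pM2l ?invr_gt0// fmax_mean.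
Qed.

(* No ghost sample is needed: one coordinate is processed at a time, splitting
   the maximum of [b + e - g] into those of [b + 2 e] and [b - 2 g]. *)
Lemma symmetrization n (a : nat -> R) :
  \int[iid_prob P n]_S
    fmax N (fun k => a k + \sum_(j < n) (e k - g k (tnth S j))) <=
  \int[iid_prob P n]_S
    savg [seq (fun k => 2 * g k (tnth S j)) | j <- enum 'I_n] (fmax N) a.
Proof.
have btnth n' k (j : 'I_n') : bmeas (fun S : n'.-tuple T => g k (tnth S j)).
  by apply: (bmeas_comp (bg k)); exact: measurable_tnth.
have bsum n' k : bmeas (fun S : n'.-tuple T => \sum_(j < n') (e k - g k (tnth S j))).
  by apply: bmeas_sum => j; apply: bmeasB => //; exact: bmeas_cst.
elim: n a => [|n IH] a.
  rewrite (_ : (fun S => _) = (fun S : 0.-tuple T => fmax N a)); last first.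
    by apply/funext => S; congr fmax; apply/funext => k; rewrite big_ord0 addr0.
  rewrite (_ : (fun S : 0.-tuple T => savg _ _ _) = (fun S => fmax N a))//.
  apply/funext => S; rewrite (_ : enum 'I_0 = [::])//.
  by apply: size0nil; rewrite size_enum_ord.
rewrite Rint_iid_cons; last first.
  by apply: bmeas_fmax => k; apply: bmeasD => //; exact: bmeas_cst.
rewrite Rint_iid_cons; last first.
  by apply: bmeas_savg => *; [exact: bmeasZ|exact: bmeas_cst].
pose Z S k := \sum_(j < n) (e k - g k (tnth (S : n.-tuple T) j)).
have bZ k : bmeas (fun p : T * n.-tuple T => Z p.2 k).
  by apply: (bmeas_comp (bsum n k)).
have bG k : bmeas (fun p : T * n.-tuple T => g k p.1).
  by apply: (bmeas_comp (bg k)).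
have FE x S : fmax N (fun k => a k +
      \sum_(j < n.+1) (e k - g k (tnth (tuple_cons (x, S)) j))) =
    fmax N (fun k => a k + Z S k + (e k - g k x)).
  congr fmax; apply/funext => k; rewrite big_ord_recl tnth0 -[RHS]addrA; congr (_ + _).
  by rewrite addrC; congr (_ + _); apply: eq_bigr => j _; rewrite tnthS.
have SE x S : savg [seq (fun k => 2 * g k (tnth (tuple_cons (x, S)) j)) | j <- enum 'I_n.+1]
      (fmax N) a =
    2^-1 * savg [seq (fun k => 2 * g k (tnth S j)) | j <- enum 'I_n] (fmax N)
      (fun k => a k + 2 * g k x) +
    2^-1 * savg [seq (fun k => 2 * g k (tnth S j)) | j <- enum 'I_n] (fmax N)
      (fun k => a k + (- 2) * g k x).
  rewrite enum_ordSl map_cons -map_comp /= mulrDr.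
  have -> : [seq ((fun j k => 2 * g k (tnth (tuple_cons (x, S)) j)) \o lift ord0) j
      | j <- enum 'I_n] =
      [seq (fun k => 2 * g k (tnth S j)) | j <- enum 'I_n].
    by apply: eq_map => j; apply/funext => k /=; rewrite tnthS.
  by congr (_ * savg _ _ _ + _ * savg _ _ _); apply/funext => k;
    rewrite tnth0 ?mulNr.
under eq_Rintegral => x _ do under eq_Rintegral => S _ do rewrite FE.
under [leRHS]eq_Rintegral => x _ do under eq_Rintegral => S _ do rewrite SE.
(* The first sample point is integrated first, with the sum [Z] over the others frozen in the
   centre. After [symmetrization_step] the order is swapped back, and the induction hypothesis is
   applied with the first point in the centre. *)
rewrite (Rint_swap _ _ (F := fun p : T * n.-tuple T =>
    fmax N (fun k => a k + Z p.2 k + (e k - g k p.1)))); last first.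
  apply: bmeas_fmax => k; apply: bmeasD.
    by apply: bmeasD => //; exact: bmeas_cst.
  by apply: bmeasB => //; exact: bmeas_cst.
have bH (c : R) : bmeas (fun p : T * n.-tuple T =>
    fmax N (fun k => a k + Z p.2 k + c * g k p.1)).
  apply: bmeas_fmax => k; apply: bmeasD; last exact: bmeasZ.
  by apply: bmeasD => //; exact: bmeas_cst.
have bHH : bmeas (fun p : T * n.-tuple T =>
    2^-1 * fmax N (fun k => a k + Z p.2 k + 2 * g k p.1) +
    2^-1 * fmax N (fun k => a k + Z p.2 k + (- 2) * g k p.1)).
  by apply: bmeasD; apply: bmeasZ; exact: bH.
apply: (@le_trans _ _ (\int[iid_prob P n]_S \int[P]_x
    (2^-1 * fmax N (fun k => a k + Z S k + 2 * g k x) +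
     2^-1 * fmax N (fun k => a k + Z S k + (- 2) * g k x)))).
  apply: le_Rint.
  - apply: (@bmeas_Rint2 _ _ _ _ _ _ (fun p => fmax N (fun k => a k + Z p.1 k + (e k - g k p.2)))).
    apply: bmeas_fmax => k; apply: bmeasD.
      by apply: bmeasD; [exact: bmeas_cst|apply: (bmeas_comp (bsum n k))].
    by apply: bmeasB; [exact: bmeas_cst|apply: (bmeas_comp (bg k))].
  - apply: (@bmeas_Rint2 _ _ _ _ _ _ (fun p =>
        2^-1 * fmax N (fun k => a k + Z p.1 k + 2 * g k p.2) +
        2^-1 * fmax N (fun k => a k + Z p.1 k + (- 2) * g k p.2))).
    apply: (bmeas_comp (g := fun p : n.-tuple T * T => (p.2, p.1)) bHH).
    exact: measurable_fun_pair.
  - by move=> S; exact: (symmetrization_step (fun k => a k + Z S k)).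
rewrite -(Rint_swap _ _ bHH)/=.
have bA (c : R) x : bmeas (fun S : n.-tuple T => fmax N (fun k => a k + Z S k + c * g k x)).
  apply: bmeas_fmax => k; apply: bmeasD; last exact: (bmeas_cst _ (c * g k x)).
  by apply: bmeasD; [exact: bmeas_cst|exact: bsum].
have bS (c : R) x : bmeas (fun S : n.-tuple T =>
    savg [seq (fun k => 2 * g k (tnth S j)) | j <- enum 'I_n] (fmax N)
      (fun k => a k + c * g k x)).
  by apply: bmeas_savg => *; [exact: bmeasZ|exact: bmeas_cst].
have bSS : bmeas (fun p : T * n.-tuple T =>
    2^-1 * savg [seq (fun k => 2 * g k (tnth p.2 j)) | j <- enum 'I_n] (fmax N)
      (fun k => a k + 2 * g k p.1) +
    2^-1 * savg [seq (fun k => 2 * g k (tnth p.2 j)) | j <- enum 'I_n] (fmax N)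
      (fun k => a k + (- 2) * g k p.1)).
  have bt j k : bmeas (fun p : T * n.-tuple T => 2 * g k (tnth p.2 j)).
    by apply: bmeasZ; apply: (bmeas_comp (btnth n k j)).
  apply: bmeasD; apply: bmeasZ; apply: bmeas_savg => // k;
    by apply: bmeasD; [exact: bmeas_cst|exact: bmeasZ].
apply: le_Rint; [exact: bmeas_Rint2 bHH|exact: bmeas_Rint2 bSS|move=> x].
rewrite !RintD; try (apply: bmeasZ; by [exact: bA|exact: bS]).
rewrite !RintZ//.
have step c : \int[iid_prob P n]_S fmax N (fun k => a k + Z S k + c * g k x) <=
    \int[iid_prob P n]_S savg [seq (fun k => 2 * g k (tnth S j)) | j <- enum 'I_n]
      (fmax N) (fun k => a k + c * g k x).
  under eq_Rintegral => S _ do under eq_fun do rewrite addrAC.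
  exact: IH.
by rewrite lerD// ler_pM2l ?invr_gt0.
Qed.

End symmetrization.

Section deviation.
Context {R : realType} d (T : measurableType d) (P : probability T R).

Lemma savg_fmax_dist N (I : Type) (s : seq I) (u u' : I -> nat -> R)
    (c : I -> R) (a a' : nat -> R) (c0 : R) :
  (forall i k, `|u i k - u' i k| <= c i) -> (forall k, `|a k - a' k| <= c0) ->
  `|savg [seq u i | i <- s] (fmax N) a - savg [seq u' i | i <- s] (fmax N) a'| <=
  c0 + \sum_(i <- s) c i.
Proof.
move=> uc; elim: s a a' c0 => [|i s IH] a a' c0 ac.
  by rewrite big_nil addr0; exact: fmax_dist.
rewrite big_cons addrA /= -mulrBr normrM ger0_norm ?invr_ge0//.
rewrite ler_pdivrMl// opprD addrACA (le_trans (ler_normD _ _))//.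
rewrite mulr2n mulrDl !mul1r lerD//; apply: IH => k.
  rewrite -[X in `|X|]/((a k + u i k) - (a' k + u' i k)) opprD addrACA.
  by rewrite (le_trans (ler_normD _ _))// lerD.
rewrite -[X in `|X|]/((a k - u i k) - (a' k - u' i k)).
rewrite (_ : _ - _ = (a k - a' k) - (u i k - u' i k)); last by ring.
by rewrite (le_trans (ler_normB _ _))// lerD.
Qed.

(** Changing one sample point moves the maximum by at most [2 M] and the sign average, whose terms
    are doubled, by at most [4 M]. Bounded differences [6 M] against the threshold with constant 8
    give the exponent [(8/9) x], which exceeds [x / 2]. The mean is nonpositive by
    symmetrization. *)
Lemma rademacher_tail N n (g : nat -> T -> R) (M x : R) : (0 < n)%N -> 0 < M ->
  (forall k, measurable_fun setT (g k)) -> (forall k x, `|g k x| <= M) -> 0 <= x ->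
  let F (S : n.-tuple T) :=
    fmax N (fun k => \sum_(j < n) (\int[P]_y g k y - g k (tnth S j))) -
    savg [seq (fun k => 2 * g k (tnth S j)) | j <- enum 'I_n] (fmax N) 0 in
  bmeas F /\
  (iid_prob P n [set S | (n%:R * (8 * M * Num.sqrt (x / n%:R)) <= F S)%R] <=
    (expR (- (x / 2)))%:E)%E.
Proof.
move=> n0 M0 mg gM x0 F.
have nR : 0 < n%:R :> R by rewrite ltr0n.
have bg k : bmeas (g k) by split => //; exists M.
have btnth k (j : 'I_n) : bmeas (fun S : n.-tuple T => g k (tnth S j)).
  by apply: (bmeas_comp (bg k)); exact: measurable_tnth.
have bF1 : bmeas (fun S : n.-tuple T =>
    fmax N (fun k => \sum_(j < n) (\int[P]_y g k y - g k (tnth S j)))).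
  apply: bmeas_fmax => k; apply: bmeas_sum => j; apply: bmeasB => //.
  exact: bmeas_cst.
have bF2 : bmeas (fun S : n.-tuple T =>
    savg [seq (fun k => 2 * g k (tnth S j)) | j <- enum 'I_n] (fmax N) 0).
  by apply: bmeas_savg => *; [exact: bmeasZ|exact: bmeas_cst].
have bF : bmeas F by exact: bmeasB.
split => //.
set e := n%:R * _.
have e0 : 0 <= e by rewrite /e mulr_ge0// mulr_ge0// mulr_ge0// ltW.
have dF : bounded_diff (6 * M) F.
  move=> S S' j SS'.
  have gS k i : `|g k (tnth S i) - g k (tnth S' i)| <= if i == j then 2 * M else 0.
    have [->|ij] := eqVneq i j; last by rewrite SS'// subrr normr0.
    rewrite (le_trans (ler_normB _ _))// mulr2n mulrDl !mul1r.
    by rewrite lerD.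
  have sumj c : \sum_(i < n) (if i == j then c else 0) = c :> R.
    by rewrite -big_mkcond big_pred1_eq.
  have split4 (p q u v : R) : p - q - (u - v) = (p - u) + (q - v) * -1 by ring.
  rewrite /F split4 mulrN1 (le_trans (ler_normB _ _))//.
  have -> : 6 * M = 2 * M + 4 * M by ring.
  apply: lerD.
    apply: fmax_dist => k _; rewrite -sumrB (le_trans (ler_norm_sum _ _ _))//.
    rewrite -[leRHS]sumj; apply: ler_sum => i _.
    have cancel (p q u : R) : p - q - (p - u) = - (q - u) by ring.
    by rewrite cancel normrN.
  rewrite -[leRHS]add0r -[X in 0 + X]sumj -big_enum.
  apply: savg_fmax_dist => [i k|k]; last by rewrite subrr normr0.
  rewrite -mulrBr normrM ger0_norm//.
  have := gS k i; case: ifP => _ H; last by rewrite -[leRHS](mulr0 2) ler_pM2l.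
  by rewrite (_ : 4 * M = 2 * (2 * M)); [rewrite ler_pM2l|ring].
have F0 : \int[iid_prob P n]_S F S <= 0.
  rewrite /F RintB// subr_le0.
  have := @symmetrization _ _ _ P N g M mg gM n 0.
  by under eq_Rintegral do under eq_fun do rewrite add0r.
apply: (le_trans (mcdiarmid n0 _ e0 bF dF F0)); first by rewrite mulr_gt0.
rewrite lee_fin ler_expR lerN2 /e.
rewrite !exprMn sqr_sqrtr; last by rewrite divr_ge0// ltW.
have -> : n%:R ^+ 2 * (8 ^+ 2 * M ^+ 2 * (x / n%:R)) /
    (2 * n%:R * (6 ^+ 2 * M ^+ 2)) = (8 / 9) * x :> R.
  by field; rewrite !gt_eqF.
by lra.
Qed.

End deviation.

(** * From finite maxima to all scales and all points *)

Section limsup_events.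
Context {R : realType} d (T : measurableType d) (P : probability T R).

(* Reverse Fatou for events. *)
Lemma limsup_prob_ge (A : nat -> set T) (p : R) :
  (forall N, measurable (A N)) -> (forall N, (p%:E <= P (A N))%E) ->
  with_prob_at_least P p [set S | forall m, exists2 N, (m <= N)%N & A N S].
Proof.
move=> mA pA; pose B m := \bigcup_(N in [set N | (m <= N)%N]) A N.
have mB m : measurable (B m) by exact: bigcup_measurable.
have mBI : measurable (\bigcap_m B m) by exact: bigcapT_measurable.
exists (\bigcap_m B m); split => //.
  by move=> S BS m; have [N mN AN] := BS m I; exists N.
have cB : (P \o B) x @[x --> \oo] --> P (\bigcap_n B n).
  apply: nonincreasing_cvg_mu => //.
    by rewrite (le_lt_trans (probability_le1 P (mB 0%N)))// ltry.
  move=> m m' mm'; apply/subsetPset => S [N /= mN AN].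
  by exists N => //=; exact: leq_trans mN.
rewrite -(cvg_lim _ cB)//; apply: lime_ge; first by apply/cvg_ex; eexists; exact: cB.
near=> m; rewrite (le_trans (pA m))// le_measure ?inE//.
by move=> S AS; exists m => /=.
Unshelve. all: by end_near. Qed.

Lemma prob_bigcap_ge (N : nat) (E : nat -> set T) (q : nat -> R) :
  (forall i, measurable (E i)) ->
  (forall i, (P (~` E i) <= (q i)%:E)%E) ->
  ((1 - \sum_(i < N) q i)%:E <= P (\big[setI/setT]_(i < N) E i))%E.
Proof.
move=> mE qE.
have -> : \big[setI/setT]_(i < N) E i = ~` (\big[setU/set0]_(i < N) ~` E i).
  elim: N => [|N IH]; first by rewrite !big_ord0 setC0.
  by rewrite !big_ord_recr IH /= setCU setCK.
have mU : measurable (\big[setU/set0]_(i < N) ~` E i).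
  by apply: bigsetU_measurable => i _; exact: measurableC.
rewrite probability_setC// EFinB leeB//.
have mC i : (i < N)%N -> measurable (~` E i) by move=> _; exact: measurableC.
apply: (le_trans (Boole_inequality P mC)).
by rewrite -sumEFin; apply: lee_sum => i _; exact: qE.
Qed.

End limsup_events.

Section uniform_deviation.
Context {R : realType} d (T : measurableType d) (P : probability T R).

(** The subtracted term makes the induction close: the slack at each step is
    [N / ((N + 2) (N + 1)^2)]. *)
Lemma sum_inv_sqr_le (N : nat) :
  \sum_(i < N) (i.+1%:R ^+ 2)^-1 <= 2 - 2 / N.+1%:R :> R.
Proof.
elim: N => [|N IH]; first by rewrite big_ord0 divr1 subrr.
rewrite big_ord_recr /= (le_trans (lerD IH (lexx _)))//.
have N0 : 0 <= N%:R :> R by [].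
rewrite -subr_ge0 -[N.+2]addn2 -[N.+1]addn1 !natrD.
have -> : 2 - 2 / (N%:R + 2%:R) - (2 - 2 / (N%:R + 1%:R) + ((N%:R + 1%:R) ^+ 2)^-1) =
  N%:R / ((N%:R + 2) * (N%:R + 1) ^+ 2) :> R.
  by field; rewrite !gt_eqF//; lra.
by rewrite divr_ge0// mulr_ge0 ?exprn_ge0//; lra.
Qed.

(** [C] is quantified after the sample, so it may depend on it in any way; measurability concerns
    only the comparison of maxima with sign averages. The index [i] stands for the scale [i + 1]. *)
Lemma uniform_deviation n (g : nat -> nat -> T -> R) (M : nat -> R) (delta : R) :
  (0 < n)%N -> (forall i, 0 < M i) ->
  (forall i k, measurable_fun setT (g i k)) ->
  (forall i k x, `|g i k x| <= M i) -> 0 < delta < 1 ->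
  with_prob_at_least (iid_prob P n) (1 - delta)
   [set S : n.-tuple T | forall i k (C : R),
     (forall N, savg [seq (fun k => 2 * g i k (tnth S j)) | j <- enum 'I_n]
                     (fmax N) 0 <= C) ->
     \sum_(j < n) (\int[P]_y g i k y - g i k (tnth S j)) <=
     C + n%:R * (8 * M i *
       Num.sqrt ((4 * ln i.+1%:R + 2 * ln (8 / delta)) / n%:R))].
Proof.
move=> n0 M0 mg gM /andP[d0 d1].
pose x i : R := 4 * ln i.+1%:R + 2 * ln (8 / delta).
have x0 i : 0 <= x i.
  rewrite addr_ge0// mulr_ge0// ln_ge0 ?ler1n//.
  by rewrite ler_pdivlMr//; lra.
pose eps i : R := n%:R * (8 * M i * Num.sqrt (x i / n%:R)).
pose F i N (S : n.-tuple T) :=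
    fmax N (fun k => \sum_(j < n) (\int[P]_y g i k y - g i k (tnth S j))) -
    savg [seq (fun k => 2 * g i k (tnth S j)) | j <- enum 'I_n] (fmax N) 0.
have tail i N := @rademacher_tail _ _ _ P N n _ _ _ n0 (M0 i) (mg i) (gM i) (x0 i).
pose E N i := [set S | (F i N S < eps i)%R].
have EC N i : ~` E N i = [set S | (eps i <= F i N S)%R].
  by apply/seteqP; split => S /=; rewrite leNgt => /negP.
have mE N i : measurable (E N i).
  rewrite -[E N i]setCK EC; apply: measurableC; rewrite -[X in measurable X]setTI.
  apply: (measurable_fun_le (f := cst (eps i)) (g := F i N)) => //.
  exact: (tail i N).1.1.
(* Stage [N] controls the first [N] scales, with maxima over the points [0] to [N]. A pair [(i, k)]
   is thus covered by every stage from [(i + k) + 1] on, and a sample lying in infinitely many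
   stages satisfies all the inequalities. *)
have := @limsup_prob_ge _ _ _ (iid_prob P n)
  (fun N => \big[setI/setT]_(i < N) E N i) (1 - delta).
case.
- by move=> N; apply: bigsetI_measurable => i _; exact: mE.
- move=> N; pose q i : R := delta / 8 * (i.+1%:R ^+ 2)^-1.
  apply: (@le_trans _ _ (1 - \sum_(i < N) q i)%:E); last first.
    apply: prob_bigcap_ge => // i; rewrite EC (le_trans (tail i N).2)//.
    rewrite lee_fin /q le_eqVlt; apply/orP; left; apply/eqP.
    (* The value [- x / 2 = - 2 ln (i + 1) - ln (8 / delta)] turns the tail into exactly
       [delta / (8 (i + 1)^2)]; as the inverse squares sum to at most 2, the total is at most
       [delta / 4]. *)
    rewrite /x (_ : - _ = - (2%:R * ln i.+1%:R) - ln (8 / delta)); last by field.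
    rewrite expRD !expRN expRM_natl !lnK ?posrE ?ltr0n ?divr_gt0//.
    by rewrite invf_div mulrC.
  rewrite lee_fin lerD2l lerN2 /q -mulr_sumr.
  have H : \sum_(i < N) (i.+1%:R ^+ 2)^-1 <= 2 :> R.
    by rewrite (le_trans (sum_inv_sqr_le N))// gerBl divr_ge0.
  rewrite (le_trans (ler_wpM2l _ H))//; first by rewrite divr_ge0// ltW.
  by lra.
move=> A [mA AE pA]; exists A; split => // S /AE /= SE i k C CN.
have [N ikN] := SE (i + k).+1.
rewrite -bigcap_mkord => /(_ i); rewrite /= (leq_ltn_trans _ ikN) ?leq_addr// => /(_ isT).
rewrite /E /F /= => H.
have kN : (k <= N)%N by rewrite (leq_trans _ (ltnW ikN))// leq_addl.
have := le_fmax (fun k => \sum_(j < n) (\int[P]_y g i k y - g i k (tnth S j))) kN.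
have := CN N; rewrite /eps /x in H; move: H; lra.
Qed.

End uniform_deviation.

(** * Gaussian laws *)

Section normal_law.
Context {R : realType}.
Notation leb := (@lebesgue_measure R).

Definition affine (a s : R) (x : measurableTypeR R) : measurableTypeR R := a + s * x.

Lemma measurable_affine (a s : R) : measurable_fun setT (affine a s).
Proof. by apply: measurable_funD => //; exact: measurable_funM. Qed.

Let pushforward_affine (m : measure (measurableTypeR R) R) (a s : R) :
    measure (measurableTypeR R) R :=
  @measure_function_pushforward__canonical__measure_function_Measure _ _ _ _ _
    m _ (measurable_affine a s).

(** Lebesgue measure and [|s|] times its image under the affine map agree on the intervals []p, q]],
    which determine it. For [s < 0] the preimage is half-open on the other side, with the same
    length. *)
Lemma ge0_integral_affine (f : R -> \bar R) (a s : R) : s != 0 ->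
  measurable_fun [set: measurableTypeR R] f -> (forall x, (0 <= f x)%E) ->
  (\int[leb]_x f x = `|s|%:E * \int[leb]_x f (affine a s x))%E.
Proof.
move=> s0 mf f0; have s_ge0 : 0 <= `|s| by [].
transitivity (\int[mscale (NngNum s_ge0) (pushforward_affine leb a s)]_x f x)%E.
  apply: eq_measure_integral => A mA _.
  apply: lebesgue_measure_unique => // X [[p q] _ <-].
  rewrite -[RHS]/(`|s|%:E * leb (affine a s @^-1` `]p, q]%classic))%E /=.
  have [sp|sn] : s > 0 \/ s < 0.
    by case: (ltrgt0P s) s0 => // _; [left|right].
  - have -> : affine a s @^-1` `]p, q]%classic = `](p - a) / s, (q - a) / s]%classic.
      apply/seteqP; split => x; rewrite /affine /= !in_itv/=.
        by rewrite ltr_pdivrMr// ler_pdivlMr// => /andP[? ?]; apply/andP; split; lra.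
      by rewrite ltr_pdivrMr// ler_pdivlMr// => /andP[? ?]; apply/andP; split; lra.
    rewrite !lebesgue_measure_itv/= !lte_fin ltr_pM2r ?invr_gt0// ltrD2r.
    case: ifP => _; last by rewrite mule0.
    by rewrite gtr0_norm// -!EFinB -EFinM; congr (_%:E); field; rewrite gt_eqF.
  - have -> : affine a s @^-1` `]p, q]%classic = `[(q - a) / s, (p - a) / s[%classic.
      apply/seteqP; split => x; rewrite /affine /= !in_itv/=.
        by rewrite ltr_ndivlMr// ler_ndivrMr// => /andP[? ?]; apply/andP; split; lra.
      by rewrite ltr_ndivlMr// ler_ndivrMr// => /andP[? ?]; apply/andP; split; lra.
    rewrite !lebesgue_measure_itv/= !lte_fin ltr_nM2r ?invr_lt0// ltrD2r.
    case: ifP => _; last by rewrite mule0.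
    by rewrite ltr0_norm// -!EFinB -EFinM; congr (_%:E); field; rewrite lt_eqF.
rewrite ge0_integral_mscale//=; congr (_ * _)%E.
by rewrite (ge0_integral_pushforward (measurable_affine a s)).
Qed.

Lemma normal_pdf_affine (a s x : R) : s != 0 ->
  `|s| * normal_pdf a s (affine a s x) = normal_pdf 0 1 x.
Proof.
move=> s0; rewrite !normal_pdfE ?oner_neq0// mulrA; congr (_ * _).
  rewrite /normal_peak expr1n mul1r -mulrnAr sqrtrM ?sqr_ge0// sqrtr_sqr.
  by rewrite invfM mulrA divff ?mul1r ?normr_eq0.
rewrite /normal_fun /affine; congr expR; rewrite addrC addKr subr0 expr1n.
by rewrite exprMn -mulr_natr; field; rewrite s0.
Qed.

Lemma normal_prob_affine (a s : R) A : s != 0 -> measurable A ->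
  normal_prob a s A = normal_prob 0 1 (affine a s @^-1` A).
Proof.
move=> s0 mA; rewrite /normal_prob.
rewrite integral_mkcond [RHS]integral_mkcond.
rewrite (@ge0_integral_affine _ a s)//; last 2 first.
- apply/(measurable_restrictT _ _).1 => //; apply/measurable_EFinP.
  by apply: measurable_funTS; exact: measurable_normal_pdf.
- by move=> x; rewrite patchE; case: ifP => // _; rewrite lee_fin normal_pdf_ge0.
rewrite -ge0_integralZl//=; last 2 first.
- apply: measurableT_comp (measurable_affine a s).
  apply/(measurable_restrictT _ _).1 => //; apply/measurable_EFinP.
  by apply: measurable_funTS; exact: measurable_normal_pdf.
- by move=> x _; rewrite patchE; case: ifP => // _; rewrite lee_fin normal_pdf_ge0.
apply: eq_integral => x _; rewrite !patchE.
have -> : (x \in affine a s @^-1` A) = (affine a s x \in A).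
  by apply/idP/idP; rewrite !inE.
case: ifP => _; last by rewrite mule0.
by rewrite -EFinM normal_pdf_affine.
Qed.

Lemma ge0_integral_normal (f : R -> \bar R) (a s : R) : s != 0 ->
  measurable_fun [set: measurableTypeR R] f -> (forall x, (0 <= f x)%E) ->
  (\int[normal_prob a s]_x f x = \int[normal_prob 0 1]_x f (affine a s x))%E.
Proof.
move=> s0 mf f0.
transitivity (\int[pushforward (normal_prob 0 1) (affine a s)]_x f x)%E.
  apply: (eq_measure_integral (pushforward_affine (normal_prob 0 1) a s)).
  by move=> A mA _; exact: normal_prob_affine.
by rewrite (ge0_integral_pushforward (measurable_affine a s)).
Qed.

(** The density agrees almost everywhere with the Radon-Nikodym derivative of the law, both having
    the same integral over every measurable set. *)
Lemma ge0_integral_normal_pdf (f : R -> \bar R) :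
  measurable_fun [set: measurableTypeR R] f -> (forall x, (0 <= f x)%E) ->
  (\int[normal_prob 0 1]_x f x = \int[leb]_x (f x * (normal_pdf 0 1 x)%:E))%E.
Proof.
move=> mf f0; have dom := @normal_prob_dominates R 0 1.
rewrite -(Radon_Nikodym_SigmaFinite.change_of_variables dom f0)//.
apply: ae_eq_integral => //.
- apply: emeasurable_funM => //; apply: measurable_int.
  exact: Radon_Nikodym_SigmaFinite.f_integrable.
- by apply: emeasurable_funM => //; apply/measurable_EFinP; exact: measurable_normal_pdf.
apply: ae_eqe_mul2l; apply: integral_ae_eq => //.
- exact: Radon_Nikodym_SigmaFinite.f_integrable.
- by apply/measurable_EFinP; exact: measurable_normal_pdf.
- by move=> E _ mE; rewrite -Radon_Nikodym_SigmaFinite.f_integral.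
Qed.

Lemma normal_integrable_id :
  (normal_prob 0 1).-integrable [set: measurableTypeR R] (fun x => x%:E).
Proof.
apply/integrableP; split; first exact/measurable_EFinP.
rewrite ge0_integral_normal_pdf//; last exact: measurableT_comp.
(* |x| <= 1 + x^2/4 <= exp (x^2/4) turns |x| pdf_1 into a multiple of pdf_(sqrt 2) *)
have two0 : Num.sqrt 2 != 0 :> R by rewrite gt_eqF// sqrtr_gt0.
pose K : R := normal_peak 1 / normal_peak (Num.sqrt 2).
have K0 : 0 <= K by rewrite divr_ge0 ?normal_peak_ge0.
apply: (@le_lt_trans _ _ (\int[leb]_x (K * normal_pdf 0 (Num.sqrt 2) x)%:E)%E).
  apply: ge0_le_integral => //=.
  - by move=> x _; rewrite mule_ge0// lee_fin ?normal_pdf_ge0.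
  - apply: emeasurable_funM; first exact: measurableT_comp.
    by apply/measurable_EFinP; exact: measurable_normal_pdf.
  - apply/measurable_EFinP; apply: measurable_funM => //.
    exact: measurable_normal_pdf.
  move=> x _; rewrite -EFinM lee_fin !normal_pdfE ?oner_neq0// /K.
  rewrite [leRHS]mulrA divfK ?gt_eqF ?normal_peak_gt0// mulrCA.
  rewrite ler_wpM2l ?normal_peak_ge0// /normal_fun subr0 expr1n sqr_sqrtr//.
  have -> : - x ^+ 2 / (1 *+ 2) = - (x ^+ 2 / 4) + (- x ^+ 2 / (2 *+ 2)).
    by rewrite !mulr2n; field.
  rewrite expRD mulrA ler_piMl ?expR_ge0// expRN ler_pdivrMr ?expR_gt0// mul1r.
  rewrite (le_trans _ (expR_ge1Dx _))//.
  have := sqr_ge0 (`|x| - 2); rewrite sqrrB real_normK ?num_real//; lra.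
under eq_integral do rewrite EFinM.
rewrite integralZl//; last exact: integrable_normal_pdf.
by rewrite integral_normal_pdf mule1 ltry.
Qed.

Lemma normal_mean : \int[normal_prob 0 1]_x (x : R) = 0.
Proof.
have intid := normal_integrable_id.
have mN := measurable_affine 0 (-1).
have E : \int[normal_prob 0 1]_x (x : R) = \int[normal_prob 0 1]_x (- x : R).
  rewrite /Rintegral; congr fine.
  transitivity (\int[pushforward (normal_prob 0 1) (affine 0 (-1))]_x x%:E)%E.
    apply: (eq_measure_integral (pushforward_affine (normal_prob 0 1) 0 (-1))).
    (* Reflection yields the law with standard deviation -1, whose density is the same since only
       the square of the deviation enters it. *)
    move=> A mA _; rewrite /= /pushforward -normal_prob_affine ?oppr_eq0 ?oner_neq0//.
    apply: eq_integral => x _; congr (_%:E).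
    by rewrite !normal_pdfE ?oppr_eq0 ?oner_neq0// /normal_peak /normal_fun !sqrrN.
  have eN (x : R) : affine 0 (-1) x = - x by rewrite /affine add0r mulN1r.
  rewrite (integral_pushforward mN)//=.
  - by apply: eq_integral => x _; rewrite eN.
  - rewrite preimage_setT; apply: eq_integrable (integrableN intid) => // x _.
    by rewrite /= eN.
have self_opp0 (z : R) : z = - z -> z = 0 by lra.
apply: self_opp0; rewrite {1}E.
by under eq_Rintegral do rewrite -mulN1r; rewrite RintegralZl// mulN1r.
Qed.

End normal_law.

(** * Product laws and Gaussian vectors *)

Section product_law.
Context {R : realType}.

Lemma ge0_integral_prod_prob_cons d (T : measurableType d) n
    (P : 'I_n.+1 -> probability T R) (f : n.+1.-tuple T -> \bar R) :
  measurable_fun setT f -> (forall t, (0 <= f t)%E) ->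
  (\int[prod_prob P]_t f t =
   \int[P ord0]_x \int[prod_prob (fun i => P (lift ord0 i))]_t f (tuple_cons (x, t)))%E.
Proof.
move=> mf f0; have mc := @measurable_tuple_cons _ T n.
transitivity (\int[P ord0 \x prod_prob (fun i => P (lift ord0 i))]_p f (tuple_cons p))%E.
  by rewrite /= (ge0_integral_pushforward mc).
by rewrite fubini_tonelli1//; exact: measurableT_comp.
Qed.

Lemma ge0_integral_prod_prob_map d (T : measurableType d) n
    (P Q : 'I_n -> probability T R) (phi : 'I_n -> T -> T) (f : n.-tuple T -> \bar R) :
  (forall i, measurable_fun setT (phi i)) ->
  (forall i (g : T -> \bar R), measurable_fun setT g -> (forall x, (0 <= g x)%E) ->
     (\int[P i]_x g x = \int[Q i]_x g (phi i x))%E) ->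
  measurable_fun setT f -> (forall t, (0 <= f t)%E) ->
  (\int[prod_prob P]_t f t =
   \int[prod_prob Q]_t f [tuple phi i (tnth t i) | i < n])%E.
Proof.
elim: n P Q phi f => [|n IH] P Q phi f mphi PQ mf f0.
  by apply: eq_integral => t _; congr f; rewrite [LHS]tuple0 [RHS]tuple0.
have mmap k (psi : 'I_k -> T -> T) : (forall i, measurable_fun setT (psi i)) ->
    measurable_fun setT (fun t : k.-tuple T => [tuple psi i (tnth t i) | i < k]).
  move=> mpsi; apply/measurable_fun_tnthP => i.
  rewrite (_ : _ \o _ = psi i \o (@tnth _ T ^~ i)).
    by apply: measurableT_comp => //; exact: measurable_tnth.
  by apply/funext => t /=; rewrite tnth_mktuple.
have mfc : measurable_fun setT (fun p : T * n.-tuple T => f (tuple_cons p)).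
  by apply: measurableT_comp => //; exact: measurable_tuple_cons.
rewrite !ge0_integral_prod_prob_cons//; last first.
  exact: (measurableT_comp mf (mmap _ phi mphi)).
have mfx x : measurable_fun setT (fun t => f (tuple_cons (x, t))).
  exact: (measurable_fun_pair2 (f := fun p => f (tuple_cons p))).
transitivity (\int[P ord0]_x \int[prod_prob (fun i => Q (lift ord0 i))]_t
    f (tuple_cons (x, [tuple phi (lift ord0 i) (tnth t i) | i < n])))%E.
  apply: eq_integral => x _.
  exact: (IH _ _ (fun i => phi (lift ord0 i)) (fun t => f (tuple_cons (x, t)))
    (fun i => mphi _) (fun i => PQ _) (mfx x) (fun t => f0 _)).
rewrite PQ//; last 2 first.
- apply: (@measurable_fun_fubini_tonelli_F _ _ _ _ _ _ (fun p => f (tuple_cons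
    (p.1, [tuple phi (lift ord0 i) (tnth p.2 i) | i < n])))) => //.
  apply: (measurableT_comp mfc); apply: measurable_fun_pair => //.
  exact: (measurableT_comp (mmap n (fun i => phi (lift ord0 i)) (fun i => mphi _))).
- by move=> x; apply: integral_ge0.
apply: eq_integral => x _; apply: eq_integral => t _; congr f.
apply: eq_from_tnth => i; rewrite tnth_mktuple.
case: (unliftP ord0 i) => [j ->|->]; last by rewrite !tnth0.
by rewrite !tnthS tnth_mktuple.
Qed.

Lemma ge0_integral_prod_prob_tnth d (T : measurableType d) n
    (P : 'I_n -> probability T R) (j : 'I_n) (f : T -> \bar R) :
  measurable_fun setT f -> (forall x, (0 <= f x)%E) ->
  (\int[prod_prob P]_t f (tnth t j) = \int[P j]_x f x)%E.
Proof.
move=> mf f0; elim: n P j => [|n IH] P j; first by case: j.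
rewrite ge0_integral_prod_prob_cons//; last first.
  by apply: measurableT_comp => //; exact: measurable_tnth.
case: (unliftP ord0 j) => [k ->|->].
  rewrite (eq_integral (cst (\int[P (lift ord0 k)]_x f x)%E)); last first.
    by move=> x _ /=; under eq_integral do rewrite tnthS;
      rewrite (IH (fun i => P (lift ord0 i))).
  by rewrite integral_cst// [X in (_ * X)%E](probability_setT (P ord0)) mule1.
apply: eq_integral => x _ /=; rewrite (eq_integral (cst (f x))); last first.
  by move=> t _; rewrite tnth0.
by rewrite integral_cst// [X in (_ * X)%E](probability_setT (prod_prob _)) mule1.
Qed.

End product_law.

Section transfer.
Context {R : realType} d d' (T : measurableType d) (U : measurableType d').
Context (P : {measure set T -> \bar R}) (Q : {measure set U -> \bar R}) (phi : U -> T).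
Hypothesis ge0_transfer : forall g : T -> \bar R, measurable_fun setT g ->
  (forall t, (0 <= g t)%E) -> (\int[P]_t g t = \int[Q]_u g (phi u))%E.

(** Changes of variables are established for nonnegative functions; the positive and negative parts
    of [f] transfer separately. *)
Lemma Rint_transfer (f : T -> R) : measurable_fun setT f ->
  \int[P]_t f t = \int[Q]_u f (phi u).
Proof.
move=> mf; have mfE : measurable_fun setT (EFin \o f) by exact/measurable_EFinP.
congr fine; rewrite integralE [RHS]integralE.
have pos := ge0_transfer (measurable_funepos mfE) (fun t => funepos_ge0 _ t).
have neg := ge0_transfer (measurable_funeneg mfE) (fun t => funeneg_ge0 _ t).
by rewrite pos neg; congr (_ - _)%E; apply: eq_integral => u _; rewrite ?funeposE ?funenegE.
Qed.

End transfer.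

Section gaussian_law.
Context {R : realType}.
Variable m : nat.
Notation mtuple := (m.-tuple (measurableTypeR R)).

Lemma integral_gauss (w : 'rV[R]_m) (s : R) (f : 'rV[R]_m -> R) : s != 0 ->
  measurable_fun setT (fun t : mtuple => f (vec t)) ->
  \int[gauss w s]_t f (vec t) = gauss_exp (fun u => f (w + s *: u)).
Proof.
move=> s0 mf.
pose shift (t : mtuple) : mtuple := [tuple affine (w 0 i) s (tnth t i) | i < m].
have vec_shift t : vec (shift t) = w + s *: vec t.
  by apply/rowP => i; rewrite !mxE tnth_mktuple.
have ge0_shift (g : mtuple -> \bar R) : measurable_fun setT g ->
    (forall t, (0 <= g t)%E) ->
    (\int[gauss w s]_t g t = \int[std_gauss m]_t g (shift t))%E.
  move=> mg g0.
  have mphi i : measurable_fun setT (affine (w 0 i) s) by exact: measurable_affine.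
  apply: (ge0_integral_prod_prob_map mphi _ mg g0) => i h mh h0.
  by rewrite (ge0_integral_normal _ s0 mh h0) mxE.
have mfE : measurable_fun setT (fun t : mtuple => (f (vec t))%:E).
  exact/measurable_EFinP.
have E := Rint_transfer ge0_shift mf.
rewrite [LHS]E; apply: eq_Rintegral => t _.
by rewrite vec_shift.
Qed.

Lemma std_gauss_integrable_coord (i : 'I_m) :
  (std_gauss m).-integrable setT (fun t : mtuple => (vec t 0 i : R)%:E).
Proof.
have mi : measurable_fun setT (fun t : mtuple => (vec t 0 i : R)).
  rewrite (_ : (fun t => _) = (@tnth _ _ ^~ i)); first exact: measurable_tnth.
  by apply/funext => t; rewrite mxE.
apply/integrableP; split; first exact/measurable_EFinP.
under eq_integral do rewrite mxE.
rewrite (ge0_integral_prod_prob_tnth (fun a : 'I_m => normal_prob ((0 : 'rV[R]_m) 0 a) 1) i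
  (f := fun x => `|x%:E|%E))//; last first.
  by apply: measurableT_comp => //; exact/measurable_EFinP.
rewrite mxE; by have /integrableP[] := @normal_integrable_id R.
Qed.

Lemma std_gauss_mean (i : 'I_m) : \int[std_gauss m]_t (vec t 0 i : R) = 0.
Proof.
pose N (a : 'I_m) := normal_prob ((0 : 'rV[R]_m) 0 a) 1 : probability (measurableTypeR R) R.
have H (g : measurableTypeR R -> \bar R) (mg : measurable_fun setT g)
    (g0 : forall x, (0 <= g x)%E) :
    (\int[N i]_x g x = \int[std_gauss m]_t g (tnth t i))%E.
  exact: esym (ge0_integral_prod_prob_tnth N i mg g0).
have mid : measurable_fun setT (fun x : measurableTypeR R => x : R) by [].
have E := Rint_transfer H mid.
have -> : \int[std_gauss m]_t (vec t 0 i : R) = \int[std_gauss m]_t (tnth t i : R).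
  by apply: eq_Rintegral => t _; rewrite mxE.
rewrite -[LHS]E /N mxE; exact: normal_mean.
Qed.

Lemma dist_mean_gauss (w : 'rV[R]_m) (s : R) : s != 0 -> dist_mean (gauss w s) = w.
Proof.
move=> s0; apply/rowP => i; rewrite mxE.
have mi : measurable_fun setT (fun t : mtuple => (vec t 0 i : R)).
  rewrite (_ : (fun t => _) = (@tnth _ _ ^~ i)); first exact: measurable_tnth.
  by apply/funext => t; rewrite mxE.
rewrite (@integral_gauss w s (fun v => v 0 i))// /gauss_exp.
have ii := std_gauss_integrable_coord i.
under eq_Rintegral do rewrite mxE [X in _ + X]mxE.
rewrite RintegralD//; last 2 first.
- by apply: bmeas_integrable; exact: bmeas_cst.
- rewrite (_ : _ \o _ = (fun t : mtuple => s%:E * (vec t 0 i)%:E)%E)//.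
  exact: integrableZl.
rewrite Rint_cst RintegralZl// std_gauss_mean mulr0 addr0//.
Qed.

End gaussian_law.

(** * Joint measurability of functions continuous in the parameter *)

Section caratheodory.
Context {R : realType}.

Lemma cvg_rowP m (u : nat -> 'rV[R]_m) (v : 'rV[R]_m) :
  (forall i, u k 0 i @[k --> \oo] --> v 0 i) -> u @ \oo --> v.
Proof.
move=> uv; apply/cvg_ballP => e e0.
have : \forall k \near \oo, forall i : 'I_m, ball (v 0 i) e (u k 0 i).
  by apply: filter_forall => i; have /cvg_ballP := uv i; apply.
by apply: filterS => k H; split => // i j; rewrite (ord1 i).
Qed.

(** A lattice of mesh [1 / (k + 1)], indexed by a countable type: it discretizes the parameter in
    [measurable_caratheodory] and supplies the centres for [dense_sequence]. *)
Definition grid m (k : nat) (z : {ffun 'I_m -> int}) : 'rV[R]_m :=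
  \row_a ((z a)%:~R / k.+1%:R).

Definition floor_index m (k : nat) (v : 'rV[R]_m) : {ffun 'I_m -> int} :=
  [ffun a => Num.floor (k.+1%:R * v 0 a)].

Lemma cvg_grid m (v : 'rV[R]_m) : grid k (floor_index k v) @[k --> \oo] --> v.
Proof.
apply: cvg_rowP => i.
have -> : (fun k => grid k (floor_index k v) 0 i) =
    (fun k => (Num.floor (k.+1%:R * v 0 i))%:~R / k.+1%:R :> R).
  by apply/funext => k; rewrite mxE ffunE.
apply/cvgrPdist_le => e e0.
have := @cvg_harmonic R => /cvgrPdist_le/(_ _ e0); apply: filterS => k.
rewrite sub0r normrN /= ger0_norm// => ke.
rewrite (le_trans _ ke)//.
have k0 : 0 < k.+1%:R :> R by [].
have -> : v 0 i - (Num.floor (k.+1%:R * v 0 i))%:~R / k.+1%:R =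
   (k.+1%:R * v 0 i - (Num.floor (k.+1%:R * v 0 i))%:~R) / k.+1%:R.
  by field.
rewrite normrM [X in _ * X]ger0_norm ?invr_ge0//.
rewrite ler_piMl ?invr_ge0//.
have /andP[H1 H2] := floor_itv (k.+1%:R * v 0 i).
by rewrite ger0_norm; [move: H2; rewrite intrD mulr1z; lra|lra].
Qed.

(** By continuity the function is the pointwise limit of its versions with the vector rounded down
    to the lattice; a preimage under a rounded version is a countable union of measurable
    rectangles. *)
Lemma measurable_caratheodory d (Z : measurableType d) m
    (f : Z -> 'rV[R]_m -> R) :
  (forall v, measurable_fun setT (f^~ v)) -> (forall z, continuous (f z)) ->
  measurable_fun setT
    (fun p : Z * m.-tuple (measurableTypeR R) => f p.1 (vec p.2)).
Proof.
move=> mf cf.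
pose h k (p : Z * m.-tuple (measurableTypeR R)) :=
  f p.1 (grid k (floor_index k (vec p.2))).
apply: (@measurable_fun_cvg _ _ _ _ h); last first.
  by move=> p _; exact: (cvg_comp _ _ (@cvg_grid _ (vec p.2)) (cf p.1 (vec p.2))).
move=> k _ B mB; rewrite setTI.
pose E (z : {ffun 'I_m -> int}) : set (m.-tuple (measurableTypeR R)) :=
  \bigcap_(a in [set: 'I_m]) [set t | z a = Num.floor (k.+1%:R * tnth t a)].
have -> : h k @^-1` B = \bigcup_(z in [set: {ffun 'I_m -> int}])
    ((f^~ (grid k z) @^-1` B) `*` E z).
  apply/seteqP; split => [[x t] /= hB|[x t] [z _ [/= fB Et]]].
    exists (floor_index k (vec t)) => //; split => //= a _ /=.
    by rewrite ffunE mxE.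
  rewrite /h /=; suff -> : floor_index k (vec t) = z by [].
  by apply/ffunP => a; rewrite ffunE mxE; have := Et a I => /= ->.
apply: countable_bigcupT_measurable; first exact: countableP.
move=> z; apply: measurableX; first by rewrite -[X in measurable X]setTI; exact: mf.
apply: fin_bigcap_measurable => // a _.
have -> : [set t : m.-tuple (measurableTypeR R) | z a = Num.floor (k.+1%:R * tnth t a)] =
    (@tnth _ _ ^~ a) @^-1` (`[(z a)%:~R / k.+1%:R, (z a + 1)%:~R / k.+1%:R[%classic : set R).
  apply/seteqP; split => t /=; rewrite in_itv /= ler_pdivrMr// ltr_pdivlMr// mulrC.
    by move=> ->; rewrite floor_itv.
  by rewrite -floor_eq => /eqP.
rewrite -[X in measurable X]setTI; apply: measurable_tnth => //.
Qed.

End caratheodory.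

(** * Lipschitz bound for the Jensen gap *)

Section directional_derivative.
Context {R : realType}.

Lemma continuous_sum (T : topologicalType) (I : Type) (s : seq I) (f : I -> T -> R) :
  (forall i, continuous (f i)) -> continuous (fun x => \sum_(i <- s) f i x).
Proof.
move=> cf; elim: s => [|i s IH].
  rewrite (_ : (fun x => _) = cst 0); first by move=> x; exact: cvg_cst.
  by apply/funext => x; rewrite big_nil.
rewrite (_ : (fun x => _) = (fun x => f i x + \sum_(j <- s) f j x)).
  by move=> x; apply: cvgD; [exact: cf|exact: IH].
by apply/funext => x; rewrite big_cons.
Qed.

Lemma dot_continuous (T : topologicalType) m (f g : T -> 'rV[R]_m) :
  continuous f -> continuous g -> continuous (fun x => dot (f x) (g x)).
Proof.
move=> cf cg; apply: continuous_sum => i x; apply: cvgM.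
  by apply: (cvg_comp f (fun M : 'rV[R]_m => M 0 i)); [exact: cf|exact: coord_continuous].
by apply: (cvg_comp g (fun M : 'rV[R]_m => M 0 i)); [exact: cg|exact: coord_continuous].
Qed.

Lemma mulmx_continuous (T : topologicalType) m p (f : T -> 'rV[R]_m)
    (g : T -> 'M[R]_(m, p)) :
  continuous f -> continuous g -> continuous (fun x => f x *m g x).
Proof.
move=> cf cg x; apply/cvg_ballP => e e0.
have : \forall y \near x, forall j : 'I_p, ball ((f x *m g x) 0 j) e ((f y *m g y) 0 j).
  apply: filter_forall => j.
  have : continuous (fun x => (f x *m g x) 0 j).
    rewrite (_ : (fun x => _) = (fun x => \sum_i f x 0 i * g x i j)); last first.
      by apply/funext => y; rewrite mxE.
    apply: continuous_sum => i z; apply: cvgM.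
      by apply: (cvg_comp f (fun M : 'rV[R]_m => M 0 i)); [exact: cf|exact: coord_continuous].
    by apply: (cvg_comp g (fun M : 'M[R]_(m, p) => M i j)); [exact: cg|exact: coord_continuous].
  by move=> /(_ x)/cvg_ballP; apply.
by apply: filterS => y H; split => // i j; rewrite (ord1 i).
Qed.

Lemma diff_grad m (f : 'rV[R]_m -> R) z v : differentiable f z ->
  'd f z v = dot v (grad f z).
Proof.
move=> df; rewrite [in LHS](row_sum_delta v) linear_sum; apply: eq_bigr => k _.
by rewrite linearZ /grad mxE deriveE.
Qed.

Lemma derive_grad m (f : 'rV[R]_m -> R) z v : differentiable f z ->
  'D_v f z = dot v (grad f z).
Proof. by move=> df; rewrite deriveE// diff_grad. Qed.

Lemma is_derive_line (V W : normedModType R) (f : V -> W) (w v : V) (t : R) (df : W) :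
  is_derive (w + t *: v) v f df ->
  is_derive t (1 : R) (fun s => f (w + s *: v)) df.
Proof.
move=> [dv <-].
have E : (fun h : R => h^-1 *:
    (((fun s => f (w + s *: v)) \o shift t) (h *: (1 : R)) - f (w + t *: v))) =
  (fun h : R => h^-1 *: ((f \o shift (w + t *: v)) (h *: v) - f (w + t *: v))).
  apply/funext => h /=; congr (_ *: (f _ - _)).
  have -> : h *: (1 : R) = h by exact: mulr1.
  by rewrite scalerDl addrCA.
by split; rewrite /derivable /derive E.
Qed.

Lemma derive_translate (V W : normedModType R) (f : V -> W) (a w v : V) :
  'D_v (fun x => f (x + a)) w = 'D_v f (w + a).
Proof.
rewrite /derive (_ : (fun h => _) =
    (fun h : R => h^-1 *: ((f \o shift (w + a)) (h *: v) - f (w + a))))//.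
by apply/funext => h /=; rewrite addrA.
Qed.

Lemma grad_translate m (f : 'rV[R]_m -> R) (a w : 'rV[R]_m) :
  grad (fun x => f (x + a)) w = grad f (w + a).
Proof. by apply/rowP => k; rewrite !mxE derive_translate. Qed.

Lemma differentiable_row_coord m C (h : 'rV[R]_m -> 'rV[R]_C) w k :
  differentiable h w -> differentiable (fun w => h w 0 k) w.
Proof.
move=> dh; apply: (@differentiable_comp _ _ _ _ h (fun M : 'rV[R]_C => M 0 k)) => //.
exact: differentiable_coord.
Qed.

Lemma derive_row_coord m C (h : 'rV[R]_m -> 'rV[R]_C) w v k :
  differentiable h w -> 'D_v (fun w => h w 0 k) w = (v *m 'J h w) 0 k.
Proof.
move=> dh; rewrite -deriveEjacobian// derive_mx ?mxE//.
exact: diff_derivable.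
Qed.

Lemma derive_chain m C (h : 'rV[R]_m -> 'rV[R]_C) (L : 'rV[R]_C -> R) w v :
  differentiable h w -> differentiable L (h w) ->
  'D_v (L \o h) w = dot (v *m 'J h w) (grad L (h w)).
Proof.
move=> dh dL; rewrite deriveE; last exact: differentiable_comp.
rewrite diff_comp//= diff_grad//; congr dot.
by rewrite -deriveEjacobian// deriveE.
Qed.

End directional_derivative.

(** * Second moments along segments *)

Section path_estimate.
Context {R : realType}.
Notation leb := (@lebesgue_measure R).

Lemma FTC_everywhere (F f : R -> R) (a b : R) : a < b ->
  (forall t : R, is_derive t (1 : R) F (f t)) -> continuous f ->
  (\int[leb]_(t in `[a, b]) (f t)%:E = (F b - F a)%:E)%E.
Proof.
move=> ab Ff cf.
have cF : continuous F.
  move=> x; apply: differentiable_continuous.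
  by apply/derivable1_diffP; apply: ex_derive.
rewrite (continuous_FTC2 ab (F := F)) ?EFinB//.
- exact: continuous_subspaceT.
- split => /=; first by move=> x _; apply: ex_derive.
  + by apply: cvg_at_right_filter; exact: cF.
  + by apply: cvg_at_left_filter; exact: cF.
- by move=> x _; rewrite derive1E; apply: derive_val.
Qed.

(** With [d k = p k 1 - p k 0], the inequality [2 d q - d^2 <= q^2] bounds the integrand from below
    by a function with the explicit primitive [F], and [F 1 - F 0 = 2 S - S = S]. *)
Lemma path_estimate C (p q : 'I_C -> R -> R) :
  (forall k (t : R), is_derive t (1 : R) (p k) (q k t)) -> (forall k, continuous (q k)) ->
  ((\sum_k (p k 1 - p k 0) ^+ 2)%:E <=
   \int[leb]_(t in `[0%R, 1%R]) (\sum_k q k t ^+ 2)%:E)%E.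
Proof.
move=> pq cq; set S := \sum_k _.
pose d k := p k 1 - p k 0.
pose F t := \sum_k (2 * d k * p k t) - S * t.
pose f t := \sum_k (2 * d k * q k t) - S.
have Ff (t : R) : is_derive t (1 : R) F (f t).
  have -> : F = \sum_k ((2 * d k) *: p k) - S *: (id : R -> R).
    by apply/funext => u; rewrite /F /= fctE fct_sumE.
  apply: is_derive_eq; congr (_ - _).
  by rewrite -[RHS]mulr1.
have cf : continuous f.
  move=> t; apply: cvgB; last exact: cvg_cst.
  by apply: continuous_sum => k u; apply: cvgM; [exact: cvg_cst|exact: cq].
have cq2 : continuous (fun t => \sum_k q k t ^+ 2).
  apply: continuous_sum => k u.
  by apply: (cvg_comp (q k) (fun x => x ^+ 2)); [exact: cq|exact: exprn_continuous].
have -> : S%:E = (F 1 - F 0)%:E.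
  congr (_%:E); rewrite /F mulr0 subr0 mulr1.
  rewrite addrAC -sumrB.
  have -> : \sum_k (2 * d k * p k 1 - 2 * d k * p k 0) = 2 * S.
    by rewrite /S mulr_sumr; apply: eq_bigr => k _; rewrite /d; ring.
  by ring.
rewrite -(FTC_everywhere ltr01 Ff cf); apply: le_integral => //=.
- apply: continuous_compact_integrable; first exact: segment_compact.
  exact: continuous_subspaceT.
- apply: continuous_compact_integrable; first exact: segment_compact.
  exact: continuous_subspaceT.
move=> t _; rewrite lee_fin /f lerBlDr /S -big_split/=.
apply: ler_sum => k _; have := sqr_ge0 (q k t - d k); rewrite /d; lra.
Qed.

End path_estimate.

Section tonelli.
Context {R : realType} {m : nat}.
Context (P : probability (m.-tuple (measurableTypeR R)) R).
Notation leb := (@lebesgue_measure R).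
Variable psi : R -> 'rV[R]_m -> R.
Hypothesis psi_ge0 : forall t u, 0 <= psi t u.
Hypothesis psi_cont_l : forall u, continuous (psi^~ u).
Hypothesis psi_cont_r : forall t, continuous (psi t).

Let mpsi : measurable_fun setT
  (fun p : measurableTypeR R * m.-tuple (measurableTypeR R) => psi p.1 (vec p.2)).
Proof.
apply: (@measurable_caratheodory _ _ (measurableTypeR R) _ psi) => // u.
exact: continuous_measurable_fun.
Qed.

Let restr (p : measurableTypeR R * m.-tuple (measurableTypeR R)) : \bar R :=
  ((\1_(`[0, 1]%classic) p.1)%:E * (psi p.1 (vec p.2))%:E)%E.

Let mrestr : measurable_fun setT restr.
Proof.
apply: emeasurable_funM; last exact/measurable_EFinP.
apply/measurable_EFinP; apply: measurableT_comp => //.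
Qed.

Let restr_ge0 p : (0 <= restr p)%E.
Proof. by rewrite mule_ge0// lee_fin. Qed.

Let integral_restr (f : R -> \bar R) :
  (\int[leb]_(t in `[0%R, 1%R]) f t = \int[leb]_t ((\1_(`[0, 1]%classic) t)%:E * f t))%E.
Proof.
rewrite integral_mkcond; apply: eq_integral => t _.
by rewrite patchE indicE; case: ifP => _; rewrite ?mul1e ?mul0e.
Qed.

Lemma tonelli_unit_interval :
  (\int[P]_u \int[leb]_(t in `[0%R, 1%R]) (psi t (vec u))%:E =
   \int[leb]_(t in `[0%R, 1%R]) \int[P]_u (psi t (vec u))%:E)%E.
Proof.
transitivity (\int[P]_u \int[leb]_t restr (t, u))%E.
  by apply: eq_integral => u _; rewrite integral_restr.
rewrite -(fubini_tonelli restr mrestr restr_ge0) integral_restr.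
apply: eq_integral => t _; rewrite -ge0_integralZl//.
- by apply/measurable_EFinP; exact: measurable_fun_pair2 mpsi.
- by move=> u _; rewrite lee_fin.
Qed.

Lemma measurable_integral_unit_interval :
  measurable_fun setT (fun u => \int[leb]_(t in `[0%R, 1%R]) (psi t (vec u))%:E)%E.
Proof.
rewrite (_ : (fun u => _) = fubini_G leb restr).
  exact: measurable_fun_fubini_tonelli_G.
by apply/funext => u; rewrite integral_restr.
Qed.

End tonelli.

Section integral_lincomb.
Context {R : realType} d (T : measurableType d) (P : measure T R) (D : set T).
Hypothesis mD : measurable D.

Lemma integrable_lincomb (I : Type) (s : seq I) (c : I -> R) (f : I -> T -> R) :
  (forall i, P.-integrable D (EFin \o f i)) ->
  P.-integrable D (EFin \o (fun x => \sum_(i <- s) c i * f i x)).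
Proof.
move=> fi; elim: s => [|i s IH].
  rewrite (_ : EFin \o _ = cst 0%E); first exact: integrable0.
  by apply/funext => x /=; rewrite big_nil.
rewrite (_ : EFin \o _ = (fun x => (c i)%:E * (f i x)%:E)
    \+ (EFin \o (fun x => (\sum_(i <- s) c i * f i x)%R)))%E.
  by apply: integrableD => //; apply: integrableZl => //; exact: fi.
by apply/funext => x /=; rewrite big_cons EFinD EFinM.
Qed.

Lemma Rintegral_lincomb (I : Type) (s : seq I) (c : I -> R) (f : I -> T -> R) :
  (forall i, P.-integrable D (EFin \o f i)) ->
  \int[P]_(x in D) (\sum_(i <- s) c i * f i x) = \sum_(i <- s) c i * \int[P]_(x in D) f i x.
Proof.
move=> fi; elim: s => [|i s IH].
  rewrite big_nil (_ : (fun x => _) = cst 0); first by rewrite Rintegral_cst// mul0r.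
  by apply/funext => x /=; rewrite big_nil.
rewrite big_cons -IH -RintegralZl// -RintegralD//.
- by apply: eq_Rintegral => x _; rewrite big_cons.
- rewrite (_ : EFin \o _ = (fun x => (c i)%:E * (f i x)%:E)%E)//.
  by apply: integrableZl => //; exact: fi.
- exact: integrable_lincomb.
Qed.

Lemma EFin_lincomb (I : Type) (s : seq I) (c : I -> R) (f : I -> T -> R) :
  (forall i, P.-integrable D (EFin \o f i)) ->
  (\int[P]_(x in D) (\sum_(i <- s) c i * f i x))%:E =
  (\int[P]_(x in D) (\sum_(i <- s) c i * f i x)%:E)%E.
Proof.
by move=> fi; rewrite fineK//; apply: integrable_fin_num => //; exact: integrable_lincomb.
Qed.

End integral_lincomb.

Section model_forms.
Context {R : realType} {X : Type} {m C : nat}.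
Variables (h : 'rV[R]_m -> X -> 'rV[R]_C) (x : X).
Hypothesis C2 : twice_cont_diff (fun w => h w x).

Let hk k w := h w x 0 k.

Lemma model_differentiable w : differentiable (fun w => h w x) w.
Proof. by case: C2. Qed.

Lemma model_coord_differentiable k w : differentiable (hk k) w.
Proof. by apply: differentiable_row_coord; exact: model_differentiable. Qed.

Lemma model_grad_differentiable k w : differentiable (grad (hk k)) w.
Proof. by case: C2 => _ /(_ k)[+ _]; apply. Qed.

Lemma model_grad_continuous k : continuous (grad (hk k)).
Proof. by move=> w; apply: differentiable_continuous; exact: model_grad_differentiable. Qed.

Lemma model_hess_continuous k : continuous (model_hess h x k).
Proof. by case: C2 => _ /(_ k)[_ +]; apply. Qed.

Lemma model_jac_grad k w u :
  (u *m 'J (fun w => h w x) w) 0 k = dot u (grad (hk k) w).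
Proof.
rewrite -derive_row_coord; last exact: model_differentiable.
exact/derive_grad/model_coord_differentiable.
Qed.

Lemma jac_form_grad w u :
  jac_form h x w u = \sum_k dot u (grad (hk k) w) ^+ 2.
Proof.
rewrite /jac_form /model_jac /jac trmxK -mulmxA -trmx_mul -dotE.
by apply: eq_bigr => k _; rewrite model_jac_grad expr2.
Qed.

Lemma hess_form_dot w u a :
  dot (a *m hess_form h x w u) a = \sum_k dot (u *m model_hess h x k w) a ^+ 2.
Proof.
rewrite /hess_form mulmx_sumr dotE mulmx_suml summxE; apply: eq_bigr => k _.
rewrite -trmx_mul -(mulmxA _ u) mulmxA -mulmxA mxE big_ord1 -!dotE.
by rewrite dotC expr2.
Qed.

Lemma is_derive_dot_grad k w u a :
  is_derive w u (fun w => dot a (grad (hk k) w)) (dot (u *m model_hess h x k w) a).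
Proof.
have D i : is_derive w u (fun w => grad (hk k) w 0 i) ((u *m model_hess h x k w) 0 i).
  have dg := @model_grad_differentiable k w.
  split; first by apply: diff_derivable; exact: differentiable_row_coord.
  exact: derive_row_coord.
have -> : (fun w => dot a (grad (hk k) w)) =
    \sum_i (a 0 i *: (fun w => grad (hk k) w 0 i)).
  by apply/funext => y; rewrite fct_sumE.
apply: is_derive_eq; rewrite dotC; exact: eq_bigr.
Qed.

End model_forms.

Section continuous_measurability.
Context {R : realType} {m : nat}.

Lemma measurable_continuous_vec (f : 'rV[R]_m -> R) : continuous f ->
  measurable_fun setT (fun t : m.-tuple (measurableTypeR R) => f (vec t)).
Proof.
move=> cf.
have := @measurable_caratheodory R _ (measurableTypeR R) m (fun _ => f).
move=> /(_ (fun v => measurable_cst _) (fun _ => cf)) H.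
exact: (measurable_fun_pair2 (0 : measurableTypeR R) H).
Qed.

Lemma continuous_line (w : 'rV[R]_m) (c : R) : continuous (fun u : 'rV[R]_m => w + c *: u).
Proof. by move=> u; exact: (cvgD (cvg_cst w) (@scaler_continuous _ _ c u)). Qed.

Lemma continuous_line_time (w u : 'rV[R]_m) (s : R) :
  continuous (fun t : R => w + (t * s) *: u).
Proof.
move=> t; apply: (cvgD (cvg_cst w)).
by apply: (@cvgZr_tmp _ _ _ _ _ (fun t => t * s)); apply: cvgMr_tmp; exact: cvg_id.
Qed.

(** The link between the path estimate and the regularity hypotheses: [f] is a squared increment
    along the segment, and [K] bounds the time-integrated Gaussian moment from which [A_j] or [B_j]
    is defined. *)
Lemma tonelli_bound (P : probability (m.-tuple (measurableTypeR R)) R)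
    (psi : R -> 'rV[R]_m -> R) (f : 'rV[R]_m -> R) (c K : R) :
  (forall t u, 0 <= psi t u) -> (forall u, continuous (psi^~ u)) ->
  (forall t, continuous (psi t)) -> (forall u, 0 <= f u) -> continuous f -> 0 <= c ->
  (forall u, ((f u)%:E <=
     c%:E * \int[@lebesgue_measure R]_(t in `[0%R, 1%R]) (psi t u)%:E)%E) ->
  (\int[@lebesgue_measure R]_(t in `[0%R, 1%R]) \int[P]_u (psi t (vec u))%:E <= K%:E)%E ->
  (\int[P]_u (f (vec u))%:E <= (c * K)%:E)%E.
Proof.
move=> psi0 cl cr f0 cf c0 fpsi psiK.
have mint := measurable_integral_unit_interval psi0 cl cr.
have int0 u : (0 <= \int[@lebesgue_measure R]_(t in `[0%R, 1%R]) (psi t (vec u))%:E)%E.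
  by apply: integral_ge0 => t _; rewrite lee_fin.
apply: (@le_trans _ _ (\int[P]_u
   (c%:E * \int[@lebesgue_measure R]_(t in `[0%R, 1%R]) (psi t (vec u))%:E))%E).
  apply: ge0_le_integral => //.
  - by move=> u _; rewrite lee_fin.
  - by apply/measurable_EFinP; exact: measurable_continuous_vec.
  - exact: measurable_funeM.
rewrite ge0_integralZl// EFinM lee_wpmul2l ?lee_fin//.
by rewrite (tonelli_unit_interval P psi0 cl cr).
Qed.

(** Jensen's inequality from the tangent to the square at the mean: [Z^2 >= 2 mu Z - mu^2]. *)
Lemma sqr_mean_le (P : probability (m.-tuple (measurableTypeR R)) R)
    (Z : m.-tuple (measurableTypeR R) -> R) (K : R) :
  P.-integrable setT (EFin \o Z) -> (\int[P]_u ((Z u) ^+ 2)%:E <= K%:E)%E ->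
  (\int[P]_u Z u) ^+ 2 <= K.
Proof.
move=> iZ ZK; set mu := \int[P]_u Z u.
have mZ : measurable_fun setT Z by apply/measurable_EFinP; exact: measurable_int iZ.
have iZ2 : P.-integrable setT (EFin \o (fun u => Z u ^+ 2)).
  apply/integrableP; split.
    by apply/measurable_EFinP; exact: measurable_funX.
  rewrite (eq_integral (fun u => (Z u ^+ 2)%:E)); last first.
    by move=> u _ /=; rewrite ger0_norm// sqr_ge0.
  exact: le_lt_trans ZK (ltry _).
have i1 : P.-integrable setT (EFin \o (fun u => 2 * mu * Z u)).
  rewrite (_ : _ \o _ = (fun u => (2 * mu)%:E * (Z u)%:E)%E)//.
  by apply: integrableZl.
have i2 : P.-integrable setT (EFin \o (fun _ : m.-tuple (measurableTypeR R) => mu ^+ 2)).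
  exact/bmeas_integrable/bmeas_cst.
have : \int[P]_u (2 * mu * Z u - mu ^+ 2) <= \int[P]_u (Z u ^+ 2).
  apply: le_Rintegral => //.
    rewrite (_ : _ \o _ = (fun u => (2 * mu * Z u)%:E - (mu ^+ 2)%:E)%E).
      exact: integrableB.
    by apply/funext => u.
  by move=> u _; have := sqr_ge0 (Z u - mu); rewrite -subr_ge0; lra.
rewrite RintegralB// RintegralZl// Rint_cst -/mu => H.
have : \int[P]_u (Z u ^+ 2) <= K.
  by rewrite -lee_fin EFin_Rintegral.
by move: H; rewrite -mulrA -expr2; lra.
Qed.

(** The matrix integrals are defined entry by entry; this form of the quadratic form commutes with
    them by linearity. *)
Lemma quad_form_sum (a : 'rV[R]_m) (M : 'M[R]_m) :
  dot (a *m M) a = \sum_(p : 'I_m * 'I_m) (a 0 p.1 * a 0 p.2) * M p.1 p.2.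
Proof.
rewrite /dot -(pair_bigA _ (fun i j => a 0 i * a 0 j * M i j))/= exchange_big/=.
apply: eq_bigr => j _; rewrite mxE mulr_suml; apply: eq_bigr => i _; ring.
Qed.

Lemma dot_loewner (M N : 'M[R]_m) (a : 'rV[R]_m) :
  loewner_le M N -> dot (a *m M) a <= dot (a *m N) a.
Proof.
move=> /psdP[_ /(_ a)]; rewrite mulmxBr dotDl dotNl; lra.
Qed.

End continuous_measurability.

Lemma continuous_fcomp (T U V : topologicalType) (f : T -> U) (g : U -> V) :
  continuous f -> continuous g -> continuous (fun x => g (f x)).
Proof. by move=> cf cg x; exact: (@continuous_comp _ _ _ f g x (cf x) (cg _)). Qed.

Lemma continuous_sub_cst {R : realType} (T : topologicalType) (f : T -> R) (c : R) :
  continuous f -> continuous (fun x => f x - c).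
Proof. by move=> cf x; exact: (cvgB (cf x) (cvg_cst c)). Qed.

Lemma continuous_mul_cst {R : realType} (T : topologicalType) (f : T -> R) (c : R) :
  continuous f -> continuous (fun x => c * f x).
Proof. by move=> cf x; exact: (cvgM (cvg_cst c) (cf x)). Qed.

Section regular_moments.
Context {R : realType} {X Y : Type} {m C : nat}.
Variables (h : 'rV[R]_m -> X -> 'rV[R]_C) (L : 'rV[R]_C -> Y -> R).
Variables (r s : R) (x : X) (y : Y) (G B : 'M[R]_m).
Hypothesis H : reg h L r s x y G B.
Notation leb := (@lebesgue_measure R).

Let hk k w := h w x 0 k.
Let C2 := reg_C2 H.
Let A := fine (jac_sup h r x s).

Lemma jac_sup_ge0 : eball r (0 : 'rV[R]_m) -> 0 <= A.
Proof.
move=> b0; apply: fine_ge0; apply: le_trans (ereal_sup_ubound _); last first.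
  by exists 0.
apply: integral_ge0 => t _; apply: integral_ge0 => u _.
by rewrite lee_fin jac_form_grad//; apply: sumr_ge0 => k _; exact: sqr_ge0.
Qed.

Let continuous_grad_line k (w u : 'rV[R]_m) :
  continuous (fun t : R => grad (hk k) (w + (t * s) *: u)).
Proof.
apply: (@continuous_fcomp _ _ _ (fun t : R => w + (t * s) *: u)).
  exact: continuous_line_time.
exact: model_grad_continuous.
Qed.

Let continuous_hess_line k (w u : 'rV[R]_m) :
  continuous (fun t : R => model_hess h x k (w + (t * s) *: u)).
Proof.
apply: (@continuous_fcomp _ _ _ (fun t : R => w + (t * s) *: u)).
  exact: continuous_line_time.
exact: model_hess_continuous.
Qed.

Let continuous_sqr_comp (T : topologicalType) (f : T -> R) :
  continuous f -> continuous (fun z => f z ^+ 2).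
Proof.
move=> cf; apply: (@continuous_fcomp _ _ _ f (fun x => x ^+ 2)) => //.
exact: exprn_continuous.
Qed.

Let is_derive_line_scaled (V : normedModType R) (f : 'rV[R]_m -> V) (w u : 'rV[R]_m)
    (t : R) (df : V) : is_derive (w + (t * s) *: u) (s *: u) f df ->
  is_derive t (1 : R) (fun t => f (w + (t * s) *: u)) df.
Proof.
rewrite -scalerA => /is_derive_line.
by rewrite (_ : (fun t => f (w + (t * s) *: u)) = (fun t => f (w + t *: (s *: u))))//;
  apply/funext => t'; rewrite scalerA.
Qed.

Let continuous_grad_shift k (w : 'rV[R]_m) (c : R) :
  continuous (fun u : 'rV[R]_m => grad (hk k) (w + c *: u)).
Proof.
apply: (@continuous_fcomp _ _ _ (fun u : 'rV[R]_m => w + c *: u)).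
  exact: continuous_line.
exact: model_grad_continuous.
Qed.

Let continuous_hess_shift k (w : 'rV[R]_m) (c : R) :
  continuous (fun u : 'rV[R]_m => model_hess h x k (w + c *: u)).
Proof.
apply: (@continuous_fcomp _ _ _ (fun u : 'rV[R]_m => w + c *: u)).
  exact: continuous_line.
exact: model_hess_continuous.
Qed.

Let measurable_unit (f : R -> R) : continuous f ->
  measurable_fun (`[0%R, 1%R]%classic : set (measurableTypeR R)) (fun t => (f t)%:E).
Proof.
move=> cf; apply/measurable_EFinP; apply: measurable_funTS.
exact: continuous_measurable_fun.
Qed.

Lemma displacement_continuous w :
  continuous (fun u : 'rV[R]_m => enorm (h (w + s *: u) x - h w x) ^+ 2).
Proof.
rewrite (_ : (fun u => _) = (fun u : 'rV[R]_m => \sum_k (hk k (w + s *: u) - hk k w) ^+ 2)).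
  apply: continuous_sum => k; apply: continuous_sqr_comp.
  apply: continuous_sub_cst.
  apply: (@continuous_fcomp _ _ _ (fun u : 'rV[R]_m => w + s *: u)).
    exact: continuous_line.
  by move=> z; apply: differentiable_continuous; exact: model_coord_differentiable.
by apply/funext => u; rewrite sqr_enorm; apply: eq_bigr => k _; rewrite !mxE expr2.
Qed.

Lemma jacobian_variation_continuous w a :
  continuous (fun u : 'rV[R]_m =>
    \sum_k (dot a (grad (hk k) (w + s *: u)) - dot a (grad (hk k) w)) ^+ 2).
Proof.
apply: continuous_sum => k; apply: continuous_sqr_comp.
apply: continuous_sub_cst.
by apply: dot_continuous; [exact: cst_continuous|exact: continuous_grad_shift].
Qed.

Lemma displacement_moment w : eball r w ->
  (\int[std_gauss m]_u
     (enorm (h (w + s *: vec u) x - h w x) ^+ 2)%:E <= (s ^+ 2 * A)%:E)%E.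
Proof.
move=> bw.
pose psi (t : R) (u : 'rV[R]_m) := \sum_k dot u (grad (hk k) (w + (t * s) *: u)) ^+ 2.
pose f (u : 'rV[R]_m) := \sum_k (hk k (w + s *: u) - hk k w) ^+ 2.
have fE u : enorm (h (w + s *: u) x - h w x) ^+ 2 = f u.
  by rewrite sqr_enorm; apply: eq_bigr => k _; rewrite !mxE expr2.
under eq_integral do rewrite fE.
have psiE t u : jac_form h x (w + (t * s) *: u) u = psi t u by rewrite jac_form_grad.
have psi0 t u : 0 <= psi t u by apply: sumr_ge0 => k _; exact: sqr_ge0.
have cl u : continuous (psi^~ u).
  apply: continuous_sum => k; apply: continuous_sqr_comp.
  by apply: dot_continuous; [exact: cst_continuous|exact: continuous_grad_line].
apply: (@tonelli_bound _ _ _ psi f (s ^+ 2)) => //.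
- move=> t; apply: continuous_sum => k; apply: continuous_sqr_comp.
  by apply: dot_continuous; [move=> ?; exact: cvg_id|exact: continuous_grad_shift].
- by move=> u; apply: sumr_ge0 => k _; exact: sqr_ge0.
- rewrite (_ : f = (fun u => enorm (h (w + s *: u) x - h w x) ^+ 2)).
    exact: displacement_continuous.
  by apply/funext => u; rewrite fE.
- exact: sqr_ge0.
- move=> u.
  have := @path_estimate R C (fun k t => hk k (w + (t * s) *: u))
    (fun k t => s * dot u (grad (hk k) (w + (t * s) *: u))).
  rewrite mul1r mul0r scale0r addr0 => P; apply: (le_trans (P _ _)).
  + move=> k t; have dk z : differentiable (hk k) z by exact: model_coord_differentiable.
    apply: is_derive_line_scaled; split; first exact: diff_derivable.
    by rewrite derive_grad// dotZl.
  + move=> k; apply: continuous_mul_cst.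
    by apply: dot_continuous; [exact: cst_continuous|exact: continuous_grad_line].
  rewrite -ge0_integralZl//; last 3 first.
  + exact: measurable_unit.
  + by move=> t _; rewrite lee_fin.
  + by rewrite lee_fin sqr_ge0.
  rewrite le_eqVlt; apply/orP; left; apply/eqP; apply: eq_integral => t _.
  by rewrite -EFinM mulr_sumr; congr (_%:E); apply: eq_bigr => k _; rewrite exprMn.
- rewrite /A fineK; last exact: reg_jac_sup H.
  apply: ereal_sup_ubound; exists w => //.
  apply: eq_integral => t _; apply: eq_integral => u _; by rewrite psiE.
Qed.

Lemma jacobian_variation_moment w a : eball r w ->
  (\int[std_gauss m]_u
     (\sum_k (dot a (grad (hk k) (w + s *: vec u)) - dot a (grad (hk k) w)) ^+ 2)%:E <=
   (s ^+ 2 * dot (a *m B) a)%:E)%E.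
Proof.
move=> bw.
pose psi (t : R) (u : 'rV[R]_m) := \sum_k dot (u *m model_hess h x k (w + (t * s) *: u)) a ^+ 2.
pose f (u : 'rV[R]_m) := \sum_k (dot a (grad (hk k) (w + s *: u)) - dot a (grad (hk k) w)) ^+ 2.
have psiE t u : dot (a *m hess_form h x (w + (t * s) *: u) u) a = psi t u.
  by rewrite hess_form_dot.
have psi0 t u : 0 <= psi t u by apply: sumr_ge0 => k _; exact: sqr_ge0.
have cl u : continuous (psi^~ u).
  apply: continuous_sum => k; apply: continuous_sqr_comp.
  apply: dot_continuous; last exact: cst_continuous.
  by apply: mulmx_continuous; [exact: cst_continuous|exact: continuous_hess_line].
apply: (@tonelli_bound _ _ _ psi f (s ^+ 2)) => //.
- move=> t; apply: continuous_sum => k; apply: continuous_sqr_comp.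
  apply: dot_continuous; last exact: cst_continuous.
  by apply: mulmx_continuous; [move=> ?; exact: cvg_id|exact: continuous_hess_shift].
- by move=> u; apply: sumr_ge0 => k _; exact: sqr_ge0.
- exact: jacobian_variation_continuous.
- exact: sqr_ge0.
- move=> u.
  have := @path_estimate R C (fun k t => dot a (grad (hk k) (w + (t * s) *: u)))
    (fun k t => s * dot (u *m model_hess h x k (w + (t * s) *: u)) a).
  rewrite mul1r mul0r scale0r addr0 => P; apply: (le_trans (P _ _)).
  + move=> k t; have := @is_derive_dot_grad _ _ _ _ h x C2 k (w + (t * s) *: u) (s *: u) a.
    by rewrite -scalemxAl dotZl; exact: is_derive_line_scaled.
  + move=> k; apply: continuous_mul_cst.
    apply: dot_continuous; last exact: cst_continuous.
    by apply: mulmx_continuous; [exact: cst_continuous|exact: continuous_hess_line].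
  rewrite -ge0_integralZl//; last 3 first.
  + exact: measurable_unit.
  + by move=> t _; rewrite lee_fin.
  + by rewrite lee_fin sqr_ge0.
  rewrite le_eqVlt; apply/orP; left; apply/eqP; apply: eq_integral => t _.
  by rewrite -EFinM mulr_sumr; congr (_%:E); apply: eq_bigr => k _; rewrite exprMn.
(* [B] dominates a matrix integrated entrywise. Expanding its form at [a] over the entries moves the
   form inside the time integral, then inside the Gaussian one. *)
- apply: (@le_trans _ _ (dot (a *m hess_int h x s w) a)%:E); last first.
    by rewrite lee_fin; apply: dot_loewner; exact: (reg_B H bw).
  rewrite quad_form_sum.
  under eq_bigr => p _ do rewrite mxE.
  rewrite -Rintegral_lincomb//; last by move=> p; exact: (reg_hess_int H).
  rewrite EFin_lincomb//; last by move=> p; exact: (reg_hess_int H).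
  rewrite le_eqVlt; apply/orP; left; apply/eqP.
  apply: eq_integral => t; rewrite inE/= in_itv/= => t01.
  under [in RHS]eq_bigr => p _ do rewrite mxE.
  rewrite -Rintegral_lincomb//; last by move=> p; exact: (reg_hess_exp H).
  rewrite EFin_lincomb//; last by move=> p; exact: (reg_hess_exp H).
  by apply: eq_integral => u _; rewrite -psiE quad_form_sum.
Qed.

End regular_moments.

Section euclidean_gradient.
Context {R : realType} {m : nat}.

Lemma enormZ (c : R) (v : 'rV[R]_m) : enorm (c *: v) = `|c| * enorm v.
Proof.
rewrite /enorm -sqrtr_sqr -sqrtrM ?sqr_ge0//; congr Num.sqrt.
by rewrite mulr_sumr; apply: eq_bigr => i _; rewrite mxE exprMn.
Qed.

Lemma eball_convex (r t : R) (w w' : 'rV[R]_m) : 0 <= t <= 1 ->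
  eball r w -> eball r w' -> eball r (w + t *: (w' - w)).
Proof.
move=> /andP[t0 t1] wr wr'; rewrite /eball /=.
have r0 : 0 <= r := le_trans (enorm_ge0 w) wr.
rewrite -(ler_pXn2r (n := 2)) ?nnegrE ?enorm_ge0// sqr_enorm.
have w2 : dot w w <= r ^+ 2 by rewrite -sqr_enorm ler_pXn2r ?nnegrE ?enorm_ge0.
have w2' : dot w' w' <= r ^+ 2 by rewrite -sqr_enorm ler_pXn2r ?nnegrE ?enorm_ge0.
have ww' : dot w w' <= r ^+ 2.
  by rewrite (le_trans (dot_le_enorm _ _))// expr2 ler_pM ?enorm_ge0.
rewrite !(dotDl, dotDr, dotNl, dotNr, dotZl, dotZr) (dotC w' w).
set p := dot w w in w2 *; set q := dot w' w' in w2' *; set c := dot w w' in ww' *.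
have P1 : 0 <= (1 - t) ^+ 2 * (r ^+ 2 - p) by rewrite mulr_ge0 ?sqr_ge0 ?subr_ge0.
have P2 : 0 <= t ^+ 2 * (r ^+ 2 - q) by rewrite mulr_ge0 ?sqr_ge0 ?subr_ge0.
have P3 : 0 <= (t * (1 - t)) * (r ^+ 2 - c) by rewrite !mulr_ge0 ?subr_ge0.
by lra.
Qed.

Lemma dot_sub_split (p q g g' : 'rV[R]_m) :
  dot p g - dot q g' = dot p (g - g') - dot (q - p) g'.
Proof. by rewrite !(dotDl, dotDr, dotNl, dotNr); ring. Qed.

Lemma dot_sub_coord (p q : 'rV[R]_m) (f g : 'I_m -> R) :
  (forall k, p 0 k = f k) -> (forall k, q 0 k = g k) ->
  dot (p - q) (p - q) = \sum_k (f k - g k) ^+ 2.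
Proof. by move=> pf qg; apply: eq_bigr => k _; rewrite !mxE pf qg expr2. Qed.

(** The difference quotients along [e] are bounded by [l * enorm e], hence so is their limit. *)
Lemma grad_lipschitz (l : R) (f : 'rV[R]_m -> R) z e :
  differentiable f z -> elipschitz l f ->
  dot e (grad f z) ^+ 2 <= l ^+ 2 * dot e e.
Proof.
move=> df lf; rewrite -derive_grad//.
have dfe : derivable f z e by exact: diff_derivable.
have bd : \forall t \near (0 : R)^', `|t^-1 *: ((f \o shift z) (t *: e) - f z)| <= l * enorm e.
  near=> t; have t0 : t != 0 by near: t; exact: nbhs_dnbhs_neq.
  rewrite normrZ normfV ler_pdivrMl ?normr_gt0//.
  rewrite (le_trans (lf _ _))// /= addrK enormZ.
  by rewrite mulrCA.
have H : `|'D_e f z| <= l * enorm e.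
  rewrite ler_norml; apply/andP; split.
    apply: limr_ge => //; apply: filterS bd => t.
    by rewrite ler_norml => /andP[].
  apply: limr_le => //; apply: filterS bd => t.
  by rewrite ler_norml => /andP[].
have le0 : 0 <= l * enorm e := le_trans (normr_ge0 _) H.
rewrite -sqr_enorm -exprMn -(real_normK (num_real ('D_e f z))).
by rewrite ler_pXn2r ?nnegrE.
Unshelve. all: by end_near. Qed.

End euclidean_gradient.

Lemma ge0_integral_le_lincomb {R : realType} d (T : measurableType d) (P : probability T R)
    (f g h : T -> R) (c c' K K' : R) :
  measurable_fun setT f -> measurable_fun setT g -> measurable_fun setT h ->
  (forall t, 0 <= f t) -> (forall t, 0 <= g t) -> (forall t, 0 <= h t) ->
  0 <= c -> 0 <= c' -> (forall t, f t <= c * g t + c' * h t) ->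
  (\int[P]_t (g t)%:E <= K%:E)%E -> (\int[P]_t (h t)%:E <= K'%:E)%E ->
  (\int[P]_t (f t)%:E <= (c * K + c' * K')%:E)%E.
Proof.
move=> mf mg mh f0 g0 h0 c0 c0' fgh gK hK.
have cg0 t : (0 <= c%:E * (g t)%:E)%E by rewrite mule_ge0 ?lee_fin.
have ch0 t : (0 <= c'%:E * (h t)%:E)%E by rewrite mule_ge0 ?lee_fin.
have mgE : measurable_fun setT (fun t => (g t)%:E) by exact/measurable_EFinP.
have mhE : measurable_fun setT (fun t => (h t)%:E) by exact/measurable_EFinP.
have mcg : measurable_fun setT (fun t => c%:E * (g t)%:E)%E by exact: measurable_funeM.
have mch : measurable_fun setT (fun t => c'%:E * (h t)%:E)%E by exact: measurable_funeM.
apply: (@le_trans _ _ (\int[P]_t (c%:E * (g t)%:E + c'%:E * (h t)%:E))%E).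
  apply: ge0_le_integral => //.
  - by move=> t _; rewrite lee_fin.
  - exact/measurable_EFinP.
  - exact: emeasurable_funD.
  - by move=> t _; rewrite -!EFinM -EFinD lee_fin.
rewrite ge0_integralD// !ge0_integralZl//; last 2 first.
- by move=> t _; rewrite lee_fin.
- by move=> t _; rewrite lee_fin.
by rewrite EFinD !EFinM leeD// lee_wpmul2l.
Qed.

Lemma integrable_cst_sub_lincomb {R : realType} d (T : measurableType d)
    (P : probability T R) (I : Type) (e : seq I) (c0 : R) (c : I -> R) (f : I -> T -> R) :
  (forall i, P.-integrable setT (EFin \o f i)) ->
  P.-integrable setT (EFin \o (fun t => c0 - \sum_(i <- e) c i * f i t)).
Proof.
move=> fi; have i0 : P.-integrable setT (EFin \o (fun _ : T => c0)).
  exact/bmeas_integrable/bmeas_cst.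
have := integrableB measurableT i0 (integrable_lincomb measurableT e c fi).
by apply: eq_integrable.
Qed.

Lemma Rintegral_cst_sub_lincomb {R : realType} d (T : measurableType d)
    (P : probability T R) (I : Type) (e : seq I) (c0 : R) (c : I -> R) (f : I -> T -> R) :
  (forall i, P.-integrable setT (EFin \o f i)) ->
  \int[P]_t (c0 - \sum_(i <- e) c i * f i t) = c0 - \sum_(i <- e) c i * \int[P]_t f i t.
Proof.
move=> fi; rewrite RintegralB//.
- by rewrite Rint_cst Rintegral_lincomb.
- exact/bmeas_integrable/bmeas_cst.
- exact: integrable_lincomb.
Qed.

(** * The seminorm that controls the Jensen gap *)

Section gap_lipschitz.
Context {R : realType} {X Y : Type} {m C : nat}.
Variables (h : 'rV[R]_m -> X -> 'rV[R]_C) (L : 'rV[R]_C -> Y -> R).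
Variables (r s l b : R) (x : X) (y : Y) (G B : 'M[R]_m).
Hypothesis H : reg h L r s x y G B.
Hypothesis L_diff : forall z, differentiable (L^~ y) z.
Hypothesis L_lip : elipschitz l (L^~ y).
Hypothesis L_smooth : esmooth b (L^~ y).
Hypothesis s_neq0 : s != 0.

Let hk k w := h w x 0 k.
Let C2 := reg_C2 H.
Let A := fine (jac_sup h r x s).
Let Lh w := L (h w x) y.
Let j (a w : 'rV[R]_m) := a *m 'J (fun w => h w x) w.

(** The 2 comes from [(p - q)^2 <= 2 p^2 + 2 q^2], the [s ^+ 2] from the speed of the path
    [t |-> w + t s u]. *)
Definition gap_metric : 'M[R]_m :=
  (2 * s ^+ 2) *: ((b ^+ 2 * A) *: G + l ^+ 2 *: B).

Lemma gap_metric_psd : eball r (0 : 'rV[R]_m) -> psd gap_metric.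
Proof.
move=> b0; have [GT G0] := psdP (reg_G_psd H); have [BT B0] := psdP (reg_B_psd H).
split; first by rewrite /gap_metric linearZ/= linearD/= linearZ/= linearZ/= GT BT.
move=> v.
have -> : (v^T *m gap_metric *m v) 0 0 = dot (v^T *m gap_metric) v^T by rewrite dotE trmxK.
rewrite /gap_metric -scalemxAr mulmxDr -!scalemxAr !(dotZl, dotDl).
have A0 : 0 <= A := jac_sup_ge0 H b0.
apply: mulr_ge0; first by rewrite mulr_ge0 ?sqr_ge0.
apply: addr_ge0; last by rewrite mulr_ge0 ?sqr_ge0.
by apply: mulr_ge0 => //; rewrite mulr_ge0 ?sqr_ge0.
Qed.

Lemma loss_differentiable w : differentiable Lh w.
Proof.
apply: (@differentiable_comp _ _ _ _ (fun w => h w x) (L^~ y)) => //.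
exact: model_differentiable.
Qed.

Lemma loss_grad a w : dot a (grad Lh w) = dot (j a w) (grad (L^~ y) (h w x)).
Proof.
rewrite -derive_grad; last exact: loss_differentiable.
by apply: (@derive_chain _ _ _ (fun w => h w x) (L^~ y)) => //; exact: model_differentiable.
Qed.

Let var (a w u : 'rV[R]_m) :=
  \sum_k (dot a (grad (hk k) (w + s *: u)) - dot a (grad (hk k) w)) ^+ 2.
Let disp (w u : 'rV[R]_m) := enorm (h (w + s *: u) x - h w x) ^+ 2.

(** The difference of products is split so that [J(w) a] meets the difference of loss gradients,
    where [G] applies since [w] is in the ball, and the variation of the Jacobian meets the loss
    gradient at the shifted point, whose Lipschitz bound holds everywhere. *)
Lemma loss_grad_variation a w (u : 'rV[R]_m) : eball r w ->
  (dot a (grad Lh w) - dot a (grad Lh (w + s *: u))) ^+ 2 <=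
  2 * b ^+ 2 * dot (a *m G) a * disp w u + 2 * l ^+ 2 * var a w u.
Proof.
move=> bw; rewrite !loss_grad; set w' := w + _.
set g := grad _ _; set g' := grad _ _.
have -> : dot (j a w) g - dot (j a w') g' =
    dot (j a w) (g - g') - dot (j a w' - j a w) g'.
  exact: dot_sub_split.
have P1 : dot (j a w) (g - g') ^+ 2 <= dot (a *m G) a * (b ^+ 2 * disp w u).
  apply: (le_trans (dot_CS _ _)); apply: ler_pM; rewrite ?dot_ge0//.
    rewrite /j dot_mulmx -mulmxA dotC.
    have := dot_loewner a (reg_G H bw).
    by rewrite /model_jac /jac trmxK mulmxA.
  rewrite -sqr_enorm /disp -exprMn.
  have [_ /(_ (h w x) (h w' x))] := L_smooth.
  rewrite -/g -/g' => P.
  have -> : enorm (h w' x - h w x) = enorm (h w x - h w' x).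
    by rewrite -opprB -scaleN1r enormZ normrN1 mul1r.
  by rewrite ler_pXn2r ?nnegrE ?enorm_ge0// (le_trans _ P)// enorm_ge0.
have P2 : dot (j a w' - j a w) g' ^+ 2 <= l ^+ 2 * var a w u.
  apply: (le_trans (grad_lipschitz _ (L_diff _) L_lip)).
  rewrite ler_wpM2l ?sqr_ge0// le_eqVlt; apply/orP; left; apply/eqP.
  have jk w0 k : j a w0 0 k = dot a (grad (hk k) w0) by exact: model_jac_grad.
  exact: dot_sub_coord (jk w') (jk w).
move: P1 P2; set p := dot _ _; set q := dot _ g' => P1 P2.
by have := sqr_ge0 (p + q); move: P1 P2; lra.
Qed.

Let gap_slope (a w u : 'rV[R]_m) := dot a (grad Lh w) - dot a (grad Lh (w + s *: u)).

Lemma gap_slope_integrable a w : eball r w -> gauss_integrable (gap_slope a w).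
Proof.
move=> bw; have [_ _ ig _] := reg_diff H bw.
rewrite /gauss_integrable.
rewrite (_ : (fun t => _) = EFin \o (fun t : m.-tuple (measurableTypeR R) =>
    dot a (grad Lh w) - \sum_i a 0 i * grad (fun w' => Lh (w' + s *: vec t)) w 0 i)).
  exact: integrable_cst_sub_lincomb.
apply/funext => t /=; congr (_ - _)%:E; apply: eq_bigr => i _.
by rewrite grad_translate.
Qed.

Lemma gap_slope_sqr_moment a w : eball r w ->
  (\int[std_gauss m]_t (gap_slope a w (vec t) ^+ 2)%:E <= (dot (a *m gap_metric) a)%:E)%E.
Proof.
move=> bw.
have mdisp := measurable_continuous_vec (displacement_continuous H (w := w)).
have mvar := measurable_continuous_vec (jacobian_variation_continuous H (w := w) (a := a)).
have dispB := displacement_moment H bw.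
have varB := jacobian_variation_moment H a bw.
have disp0 u : 0 <= disp w u by exact: sqr_ge0.
have var0 u : 0 <= var a w u by apply: sumr_ge0 => k _; exact: sqr_ge0.
have G0 : 0 <= dot (a *m G) a by have [_] := psdP (reg_G_psd H); apply.
have mZ : measurable_fun setT (fun t : m.-tuple (measurableTypeR R) => gap_slope a w (vec t)).
  apply/measurable_EFinP; have := @gap_slope_integrable a w bw.
  by rewrite /gauss_integrable => /measurable_int.
have b0 : 0 <= 2 * b ^+ 2 * dot (a *m G) a by rewrite mulr_ge0// mulr_ge0 ?sqr_ge0.
have l0 : 0 <= 2 * l ^+ 2 by rewrite mulr_ge0 ?sqr_ge0.
have K := ge0_integral_le_lincomb (measurable_funX 2 mZ) mdisp mvar
  (fun t => sqr_ge0 _) (fun t => disp0 (vec t)) (fun t => var0 (vec t))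
  b0 l0 (fun t => loss_grad_variation a (vec t) bw) dispB varB.
apply: (le_trans K); rewrite lee_fin le_eqVlt; apply/orP; left; apply/eqP.
rewrite /gap_metric -scalemxAr mulmxDr -!scalemxAr !(dotZl, dotDl) -/A.
by ring.
Qed.

Lemma gap_slope_mean_sqr a w : eball r w ->
  gauss_exp (gap_slope a w) ^+ 2 <= dot (a *m gap_metric) a.
Proof.
by move=> bw; apply: sqr_mean_le; [exact: gap_slope_integrable|exact: gap_slope_sqr_moment].
Qed.

Let smoothing_gap (w : 'rV[R]_m) := Lh w - gauss_exp (fun u => Lh (w + s *: u)).

Lemma smoothing_gap_derive a w : eball r w ->
  is_derive w a smoothing_gap (gauss_exp (gap_slope a w)).
Proof.
move=> bw; have [_ dE ig gE] := reg_diff H bw.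
pose E w := gauss_exp (fun u => Lh (w + s *: u)).
pose g i t := grad (fun w' => Lh (w' + s *: vec t)) w 0 i.
have DE : 'D_a E w = \sum_i a 0 i * \int[std_gauss m]_t g i t.
  rewrite derive_grad//; apply: eq_bigr => i _; congr (_ * _).
  by have /rowP/(_ i) := gE; rewrite [in X in _ = X -> _]mxE.
have gZ : gauss_exp (gap_slope a w) = 'D_a Lh w - 'D_a E w.
  rewrite DE derive_grad; last exact: loss_differentiable.
  rewrite -(Rintegral_cst_sub_lincomb (P := std_gauss m) _ _ _ ig).
  apply: eq_Rintegral => t _; congr (_ - _); apply: eq_bigr => i _.
  exact: (congr1 (fun v : 'rV[R]_m => a 0 i * v 0 i) (esym (grad_translate Lh (s *: vec t) w))).
rewrite gZ; apply: is_deriveB.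
- by split => //; apply: diff_derivable; exact: loss_differentiable.
- by split => //; exact: diff_derivable.
Qed.

(** The segment stays in the ball by convexity, and the mean value theorem expresses the increment
    as one derivative in the direction [a]. The metric is the same at all points, so a bound at the
    unknown intermediate point is enough. *)
Lemma smoothing_gap_lipschitz w w' : eball r w -> eball r w' ->
  (smoothing_gap w' - smoothing_gap w) ^+ 2 <= dot ((w' - w) *m gap_metric) (w' - w).
Proof.
move=> bw bw'; set a := w' - w.
have bt (t : R) : 0 <= t <= 1 -> eball r (w + t *: a) by move=> t01; exact: eball_convex.
pose f t := smoothing_gap (w + t *: a).
have df (t : R) : 0 <= t <= 1 ->
    is_derive t (1 : R) f (gauss_exp (gap_slope a (w + t *: a))).
  by move=> t01; apply: is_derive_line; apply: smoothing_gap_derive; exact: bt.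
have df' (t : R) : t \in `]0, 1[ ->
    is_derive t (1 : R) f (gauss_exp (gap_slope a (w + t *: a))).
  by rewrite in_itv/= => /andP[/ltW t0 /ltW t1]; apply: df; rewrite t0.
have cf : {within `[0, 1], continuous f}.
  apply: derivable_within_continuous => t; rewrite in_itv/= => t01.
  by have [] := df t t01.
have [t t01] := MVT_segment ler01 df' cf.
rewrite /f scale1r scale0r addr0 subr0 mulr1 [w + a]addrC subrK => ->.
by apply: gap_slope_mean_sqr; apply: bt; move: t01; rewrite in_itv.
Qed.

Lemma jensen_gap_smoothing w : jensen_gap (gauss w s) Lh = smoothing_gap w.
Proof.
have mLh : measurable_fun setT (fun t : m.-tuple (measurableTypeR R) => Lh (vec t)).
  apply: measurable_continuous_vec => z; apply: differentiable_continuous.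
  exact: loss_differentiable.
by rewrite /jensen_gap (dist_mean_gauss w s_neq0) (integral_gauss w s_neq0 mLh).
Qed.

Lemma jensen_gap_lipschitz w w' : eball r w -> eball r w' ->
  (jensen_gap (gauss w' s) (fun v => L (h v x) y) -
   jensen_gap (gauss w s) (fun v => L (h v x) y)) ^+ 2 <=
  dot ((w' - w) *m gap_metric) (w' - w).
Proof. by rewrite !jensen_gap_smoothing; exact: smoothing_gap_lipschitz. Qed.

Lemma gap_metric_trace :
  \tr gap_metric = 2 * s ^+ 2 * (b ^+ 2 * (A * \tr G) + l ^+ 2 * \tr B).
Proof. by rewrite /gap_metric !(mxtraceZ, mxtraceD) -/A; ring. Qed.

End gap_lipschitz.

(** * Assembly *)

Section parametrized_integral.
Context {R : realType}.

(** The gap is bounded but the loss may not be; measurability of its Gaussian mean in the data point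
    therefore goes through positive and negative parts. *)
Lemma measurable_Rintegral_param d d' (Z : measurableType d) (T : measurableType d')
    (P : probability T R) (f : Z * T -> R) : measurable_fun setT f ->
  measurable_fun setT (fun z => \int[P]_t f (z, t)).
Proof.
move=> mf; have mfE : measurable_fun setT (fun p => (f p)%:E) by exact/measurable_EFinP.
have m1 := measurable_fun_fubini_tonelli_F (m2 := P) _
  (measurable_funepos mfE) (fun p => funepos_ge0 _ p).
have m2 := measurable_fun_fubini_tonelli_F (m2 := P) _
  (measurable_funeneg mfE) (fun p => funeneg_ge0 _ p).
rewrite (_ : (fun z => _) = fine \o (fun z => fubini_F P (fun p => (f p)%:E)^\+ z -
    fubini_F P (fun p => (f p)%:E)^\- z)%E).
  by apply: measurableT_comp => //; exact: emeasurable_funB.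
apply/funext => z /=; rewrite /Rintegral integralE /fubini_F.
by congr (fine (_ - _)); apply: eq_integral => t _; rewrite ?funeposE ?funenegE.
Qed.

Lemma bounded_cvg_Rintegral d (T : measurableType d) (P : probability T R)
    (f : nat -> T -> R) (g : T -> R) (K : R) :
  (forall k, measurable_fun setT (f k)) -> (forall k x, `|f k x| <= K) ->
  (forall x, f k x @[k --> \oo] --> g x) ->
  \int[P]_x f k x @[k --> \oo] --> \int[P]_x g x.
Proof.
move=> mf fK fg; have mg : measurable_fun setT g.
  by apply: (@measurable_fun_cvg _ _ _ _ f) => // x _; exact: fg.
have gK x : `|g x| <= K.
  rewrite -(cvg_lim (@Rhausdorff R) (cvg_norm (fg x))).
  apply: limr_le; last by exact: nearW.
  by apply/cvg_ex; exists `|g x|; exact: (cvg_norm (fg x)).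
have [|||||_ _] := @dominated_convergence _ _ _ P setT measurableT
  (fun k x => (f k x)%:E) (fun x => (g x)%:E) (fun _ => K%:E).
- by move=> k; exact/measurable_EFinP.
- exact/measurable_EFinP.
- by apply: aeW => x _; apply/cvg_EFin; [exact: nearW|exact: fg].
- exact/bmeas_integrable/bmeas_cst.
- by apply: aeW => x k _; rewrite lee_fin.
have bg : bmeas g by split => //; exists K.
rewrite -EFin_Rintegral; last exact: bmeas_integrable.
by move=> /fine_cvg.
Qed.

End parametrized_integral.

Section dense_sequence.
Context {R : realType} {m : nat}.

(** Lattice points may miss [A]. For each lattice point and each radius [1 / (k + 1)], a point of
    [A] within that radius is chosen, with [w0] as default when there is none; these choices are
    countably many. *)
Lemma dense_sequence (A : set 'rV[R]_m) (w0 : 'rV[R]_m) : A w0 ->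
  exists2 q : nat -> 'rV[R]_m, (forall k, A (q k)) &
    forall w, A w -> exists kappa : nat -> nat, q (kappa n) @[n --> \oo] --> w.
Proof.
move=> Aw0.
pose I := (nat * {ffun 'I_m -> int} * nat)%type.
pose near_grid (i : I) : set 'rV[R]_m :=
  A `&` [set v | `|grid i.1.1 i.1.2 - v| < i.2.+1%:R^-1].
pose pick (i : I) := xget w0 (near_grid i).
have pickA i : A (pick i).
  rewrite /pick; case: xgetP => [v _ [] //|_]; exact: Aw0.
exists (fun k => if unpickle k is Some i then pick i else w0).
  by move=> k; case: unpickle.
move=> w Aw.
(* A lattice point within [1 / (n + 1)] of [w] is taken; [w] itself shows that a choice within that
   radius exists, and the two distances add up. *)
have ex n : exists k, `|w - (if unpickle k is Some i then pick i else w0)| < 2 * n.+1%:R^-1.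
  have n0 : 0 < n.+1%:R^-1 :> R by [].
  have /cvgrPdist_lt/(_ _ n0)[N _ /(_ N (leqnn N))] := @cvg_grid R m w.
  move=> /= HN; exists (pickle ((N, floor_index N w, n) : I)).
  rewrite pickleK.
  have [] : near_grid (N, floor_index N w, n) (pick (N, floor_index N w, n)).
    by apply: (xgetPex w0); exists w; split => //=; rewrite distrC.
  move=> _ /= Hp; rewrite -(subrKA (grid N (floor_index N w))).
  by rewrite (le_lt_trans (ler_normD _ _))// mulr2n mulrDl !mul1r ltrD.
have [kappa Hk] := choice ex.
exists kappa; apply/cvgrPdist_lt => e e0.
have e20 : 0 < e / 2 by rewrite divr_gt0.
have /cvgrPdist_lt/(_ _ e20) := @cvg_harmonic R.
apply: filterS => n; rewrite sub0r normrN ger0_norm//= => ne.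
have {}ne : n.+1%:R^-1 < e / 2 := ne.
by rewrite (lt_le_trans (Hk n))// mulrC -ler_pdivlMr// ltW.
Qed.

End dense_sequence.

Lemma cvg_sumr {R : realType} (I : Type) (s : seq I) (f : I -> nat -> R) (g : I -> R) :
  (forall i, f i k @[k --> \oo] --> g i) ->
  \sum_(i <- s) f i k @[k --> \oo] --> \sum_(i <- s) g i.
Proof.
move=> fg; elim: s => [|i s IH].
  rewrite big_nil (_ : (fun k => _) = cst 0); first exact: cvg_cst.
  by apply/funext => k; rewrite big_nil.
rewrite big_cons (_ : (fun k => _) = (fun k => f i k + \sum_(j <- s) f j k)).
  exact: (cvgD (fg i) IH).
by apply/funext => k; rewrite big_cons.
Qed.

Lemma dist_lt_sqr {R : realType} (x y e : R) : 0 < e ->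
  (y - x) ^+ 2 < e ^+ 2 -> `|x - y| < e.
Proof.
move=> e0; rewrite distrC -(real_normK (num_real (y - x))).
by rewrite ltr_pXn2r ?nnegrE// ltW.
Qed.

Lemma psdZ {R : realType} m (c : R) (M : 'M[R]_m) : 0 <= c -> psd M -> psd (c *: M).
Proof.
move=> c0 [MT M0]; split; first by rewrite linearZ/= MT.
by move=> v; rewrite -scalemxAr -scalemxAl mxE mulr_ge0.
Qed.

Theorem proposition7p10 (R : realType) :
  exists2 c : R, 0 < c &
  forall (dX dY : measure_display)
    (X : measurableType dX) (Y : measurableType dY)
    (D : probability (X * Y)%type R) (n m C : nat)
    (h : 'rV[R]_m -> X -> 'rV[R]_C) (L : 'rV[R]_C -> Y -> R)
    (r smax l b B : R)
    (G : n.-tuple (X * Y) -> 'I_n -> 'M[R]_m)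
    (Bm : n.-tuple (X * Y) -> R -> 'I_n -> 'M[R]_m),
  let Theta : set 'rV[R]_m := eball r in
  let sigma (i : nat) : R := 2 ^ (1 - i%:Z) * smax in
  let Q (w : 'rV[R]_m) (i : nat) := gauss w (sigma i) in
  let gap (w : 'rV[R]_m) (i : nat) (p : X * Y) : R :=
    jensen_gap (Q w i) (fun v => L (h v p.1) p.2) in
  (0 < n)%N ->
  0 < smax ->
  (forall w, measurable_fun setT (fun p : X * Y => L (h w p.1) p.2)) ->
  (forall y, (forall z, differentiable (fun z' => L z' y) z) /\
     elipschitz l (fun z => L z y) /\ esmooth b (fun z => L z y)) ->
  (forall i, (1 <= i)%N -> forall (S : n.-tuple (X * Y)) (j : 'I_n),
     reg h L r (sigma i) (tnth S j).1 (tnth S j).2 (G S j) (Bm S (sigma i) j)) ->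
  0 < B ->
  (forall (p : X * Y) w i, Theta w -> (1 <= i)%N ->
     `|gap w i p| <= sigma i ^+ 2 * B) ->
  forall delta : R, 0 < delta < 1 ->
  with_prob_at_least (iid_prob D n) (1 - delta)
    [set S : n.-tuple (X * Y) | forall i w, (1 <= i)%N -> Theta w ->
       \int[D]_p gap w i p <=
         n%:R^-1 * \sum_(j < n) gap w i (tnth S j)
         + 2 * c * (r * sigma i / Num.sqrt n%:R)
             * Num.sqrt (b ^+ 2 * J_avg h r (G S) (sigma i)
                                    (fun j => (tnth S j).1)
                         + l ^+ 2 * H_avg (Bm S (sigma i)))
         + 8 * sigma i ^+ 2 * B
             * Num.sqrt ((4 * ln i%:R + 2 * ln (8 / delta)) / n%:R)].
Proof.
exists (Num.sqrt 8); first by rewrite sqrtr_gt0.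
move=> dX dY X Y D n m C h L r smax l b B G Bm Theta sigma Q gap.
move=> n0 smax0 mL HL Hreg B0 HB delta d01.
have [r0|r0] := ltP r 0.
  exists setT; split => //.
    move=> S _ i w _; rewrite /Theta /eball/= => wr.
    by have := le_lt_trans (enorm_ge0 w) (le_lt_trans wr r0); rewrite ltxx.
  by rewrite probability_setT lee_fin; case/andP: d01; lra.
have sigma_gt0 i : 0 < sigma i by rewrite /sigma mulr_gt0// exprz_gt0.
(* Regularity is assumed along samples; at an arbitrary [p] it is read off the sample that repeats
   [p]. This gives continuity in the parameter at every data point, not only at those of [S]. *)
have reg_p i (p : X * Y) : (1 <= i)%N ->
    exists G0 B0, reg h L r (sigma i) p.1 p.2 G0 B0.
  move=> i1; have := Hreg i i1 [tuple of nseq n p] (Ordinal n0).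
  rewrite (tnth_nth p) nth_nseq /= n0 => H; by eexists; eexists; exact: H.
have mgap w i : (1 <= i)%N -> measurable_fun setT (gap w i).
  move=> i1; rewrite /gap /jensen_gap; apply: measurable_funB.
    exact: mL.
  apply: (@measurable_Rintegral_param _ _ _ _ _ (Q w i)
     (fun pt => L (h (vec pt.2) pt.1.1) pt.1.2)).
  apply: (@measurable_caratheodory _ _ _ _ (fun p v => L (h v p.1) p.2)).
    exact: mL.
  move=> p v; have [G1 [B1 H1]] := reg_p i p i1.
  apply: differentiable_continuous; apply: (loss_differentiable H1).
  by move=> z; have [] := HL p.2.
have w00 : Theta 0 by rewrite /Theta/eball/= /enorm big1 ?sqrtr0// => i _; rewrite mxE expr0n.
have [q qT qdense] := dense_sequence w00.
have gap_lip i (p : X * Y) G1 B1 w w' : (1 <= i)%N ->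
    reg h L r (sigma i) p.1 p.2 G1 B1 -> Theta w -> Theta w' ->
    (gap w' i p - gap w i p) ^+ 2 <=
    dot ((w' - w) *m gap_metric h r (sigma i) l b p.1 G1 B1) (w' - w).
  move=> i1 H Tw Tw'; have [Ld [Ll Ls]] := HL p.2.
  apply: (jensen_gap_lipschitz H) => //.
  by rewrite gt_eqF.
have MB i : 0 < sigma i.+1 ^+ 2 * B by rewrite mulr_gt0// exprn_gt0.
have gB i k p : `|gap (q k) i.+1 p| <= sigma i.+1 ^+ 2 * B by exact: HB.
have [A [mA AE pA]] := uniform_deviation D n0 MB (fun i k => mgap (q k) i.+1 isT) gB d01.
exists A; split => // S /AE/= SE [//|i] w _ Tw.
have HR j := Hreg i.+1 isT S j.
pose MG j := gap_metric h r (sigma i.+1) l b (tnth S j).1 (G S j) (Bm S (sigma i.+1) j).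
(* The 4 is the square of the factor 2 that symmetrization puts on the gaps. *)
have rad N : savg [seq (fun k => 2 * gap (q k) i.+1 (tnth S j)) | j <- enum 'I_n] (fmax N) 0 <=
    2 * r * Num.sqrt (\sum_j \tr (4 *: MG j)).
  apply: (@lipschitz_rademacher _ _ _ _ q r (fun j k => 2 * gap (q k) i.+1 (tnth S j))) => //.
    by move=> j; apply: psdZ => //; apply: gap_metric_psd (HR j) _ => //.
  move=> j k k'; rewrite -mulrBr exprMn -scalemxAr dotZl.
  have -> : (2 : R) ^+ 2 = 4 by ring.
  rewrite ler_pM2l//; exact: (gap_lip _ _ _ _ _ _ _ (HR j)).
set J := J_avg _ _ _ _ _; set HH := H_avg _.
(* Here [8 = 4 * 2], the 2 being that of [gap_metric], and [n] undoes the averaging in [J] and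
   [HH]. *)
have trE : \sum_j \tr (4 *: MG j) =
    8 * sigma i.+1 ^+ 2 * n%:R * (b ^+ 2 * J + l ^+ 2 * HH).
  under eq_bigr do rewrite mxtraceZ gap_metric_trace.
  have n_neq0 : n%:R != 0 :> R by rewrite pnatr_eq0 -lt0n.
  rewrite /J /HH /J_avg /H_avg.
  set SA := \sum_(j < n) fine _ * _; set SB := \sum_(j < n) \tr (Bm _ _ _).
  transitivity (8 * sigma i.+1 ^+ 2 * (b ^+ 2 * SA + l ^+ 2 * SB)); last by field.
  rewrite /SA /SB (mulr_sumr _ _ _ (b ^+ 2)) (mulr_sumr _ _ _ (l ^+ 2)) -big_split/= mulr_sumr.
  by apply: eq_bigr => j _; ring.
have key k := SE i k _ rad.
have [kappa kq] := qdense w Tw.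
(* The integral over [D] needs convergence at every [p], so the seminorm used is that of the
   constant sample at [p], with its own matrices [G1] and [B1]. *)
have gcv p : gap (q (kappa k)) i.+1 p @[k --> \oo] --> gap w i.+1 p.
  have [G1 [B1 H1]] := reg_p i.+1 p isT.
  set Mx := gap_metric h r (sigma i.+1) l b p.1 G1 B1.
  have cM : continuous (fun a : 'rV[R]_m => dot (a *m Mx) a).
    apply: dot_continuous; last by move=> ?; exact: cvg_id.
    by apply: mulmx_continuous; [move=> ?; exact: cvg_id|exact: cst_continuous].
  have dq : (q (kappa k) - w) @[k --> \oo] --> (0 : 'rV[R]_m).
    by rewrite -[X in _ --> X](subrr w); exact: (cvgB kq (cvg_cst w)).
  have form0 : dot (0 *m Mx) 0 = 0 by rewrite mul0mx dotE mul0mx mxE.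
  have dM := cvg_comp _ _ dq (cM 0); rewrite form0 in dM; apply/cvgrPdist_lt => e e0.
  have e20 : 0 < e ^+ 2 by rewrite exprn_gt0.
  have /cvgrPdist_lt/(_ _ e20) := dM; apply: filterS => k.
  rewrite sub0r normrN => /(le_lt_trans (ler_norm _)) /= dk.
  apply: (dist_lt_sqr e0).
  exact: le_lt_trans (gap_lip i.+1 p _ _ w (q (kappa k)) isT H1 Tw (qT _)) dk.
have Icv := bounded_cvg_Rintegral (P := D) (fun k => mgap (q (kappa k)) i.+1 isT)
  (fun k => gB i (kappa k)) gcv.
(* The right-hand side does not depend on the parameter, so the bound on the dense sequence passes
   to the limit [w]; the integrals converge by domination with [s^2 B]. *)
have lim_le : n%:R * \int[D]_p gap w i.+1 p - \sum_j gap w i.+1 (tnth S j) <=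
    2 * r * Num.sqrt (\sum_j \tr (4 *: MG j)) +
    n%:R * (8 * (sigma i.+1 ^+ 2 * B) *
      Num.sqrt ((4 * ln i.+1%:R + 2 * ln (8 / delta)) / n%:R)).
  have ucv : (n%:R * \int[D]_p gap (q (kappa k)) i.+1 p -
      \sum_j gap (q (kappa k)) i.+1 (tnth S j)) @[k --> \oo] -->
    n%:R * \int[D]_p gap w i.+1 p - \sum_j gap w i.+1 (tnth S j).
    apply: cvgB; first by apply: cvgMl_tmp.
    by apply: cvg_sumr => j; exact: gcv.
  rewrite -(cvg_lim (@Rhausdorff R) ucv); apply: limr_le.
    by apply/cvg_ex; eexists; exact: ucv.
  apply: nearW => k; have := key (kappa k).
  by rewrite sumrB sumr_const card_ord -[_ *+ n]mulr_natl.
have nR : 0 < n%:R :> R by rewrite ltr0n.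
have sn0 : Num.sqrt n%:R != 0 :> R by rewrite gt_eqF// sqrtr_gt0.
have nE : n%:R = Num.sqrt n%:R ^+ 2 :> R by rewrite sqr_sqrtr// ltW.
move: lim_le; rewrite trE.
have -> : Num.sqrt (8 * sigma i.+1 ^+ 2 * n%:R * (b ^+ 2 * J + l ^+ 2 * HH)) =
    Num.sqrt 8 * sigma i.+1 * Num.sqrt n%:R * Num.sqrt (b ^+ 2 * J + l ^+ 2 * HH).
  have s8 : 0 <= 8 * sigma i.+1 ^+ 2 by rewrite mulr_ge0// sqr_ge0.
  rewrite sqrtrM; last by rewrite mulr_ge0.
  by rewrite (sqrtrM _ s8) sqrtrM// sqrtr_sqr gtr0_norm.
set U := Num.sqrt (_ / n%:R).
set I := \int[D]_p _; set W := \sum_j _ => lim_le.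
rewrite -(ler_pM2l nR) -subr_ge0.
move: lim_le; rewrite -subr_ge0; congr (0 <= _).
set N := Num.sqrt n%:R in sn0 nE *; rewrite nE; by field.
Qed.
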